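(* Let $n\ge 3$. With the commutativity relators taken up to reversal (that is, keeping only one of $[u,v]=1$ and $[v,u]=1$), and with the tautological relation $b=\tau_{2,1}(a,b)$ omitted, the presentation $\mathrm{SL}_n(\mathbb Z)\cong\langle a,b\mid\mathcal R_n(a,b)\rangle$ may be written with exactly $$\frac12\,n(n+1)(n-1)(n-2)+2$$ defining relators.
   Context: Commutators are $[x,y]=x^{-1}y^{-1}xy$, a relation $U=V$ means the relator $UV^{-1}$, and $\varepsilon_n=(-1)^{n-1}$. Relators are counted by their indexing (one for each relation in the list below, after keeping one orientation for each commuting pair in family (1)). The words $\tau_{ij}=\tau_{i,j}=\tau_{ij}(a,b)$ in the free group on $a,b$ ($1\le i\ne j\le n$) are defined as follows. Step 1: $\tau_{r+1,r}:=a^{-(r-1)}ba^{r-1}$ for $1\le r\le n-1$, and $\tau_{1n}:=\bigl(a^{-(n-1)}ba^{n-1}\bigr)^{\varepsilon_n}$. Step 2: for $d=2,\dots,n-1$ successively and all $i,j$ with $i-j=d$, $\tau_{ij}:=[\tau_{i,j+1},\tau_{j+1,j}]$. Step 3: for $2\le i\le n-1$, $\tau_{in}:=[\tau_{i1},\tau_{1n}]$. Step 4: for $1\le i<j\le n-1$, $\tau_{ij}:=[\tau_{in},\tau_{nj}]$. $\mathcal R_n(a,b)$ denotes the following list of relations (indices in $\{1,\dots,n\}$), which does not include $b=\tau_{2,1}(a,b)$: (1) $[\tau_{i,j},\tau_{k,l}]=1$ for all $i\neq j$, $k\ne l$ with $(i,j)\ne(k,l)$, $i\ne l$, $j\ne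 k$; (2) $[\tau_{i,j},\tau_{j,k}]=\tau_{i,k}$ for distinct $i,j,k$; (3) $(\tau_{1,2}\tau_{2,1}^{-1}\tau_{1,2})^4=1$; (4) $a=(\tau_{n-1,n}\tau_{n,n-1}^{-1}\tau_{n-1,n})(\tau_{n-2,n-1}\tau_{n-1,n-2}^{-1}\tau_{n-2,n-1})\cdots(\tau_{1,2}\tau_{2,1}^{-1}\tau_{1,2})$. The generators $a,b$ correspond to the matrices $a_n=\sum_{i=1}^{n-1}E_{i,i+1}+\varepsilon_nE_{n,1}$ and $b_n=I_n+E_{2,1}$, where $E_{i,j}$ is the standard $n\times n$ matrix unit. *)

(* Defs.v *)
From HB Require Import structures.
From mathcomp Require Import all_boot all_order all_algebra.
From mathcomp Require Import generic_quotient boolp.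

Set Implicit Arguments.
Unset Strict Implicit.
Unset Printing Implicit Defensive.

Import GRing.Theory.
Local Open Scope quotient_scope.
Local Open Scope group_scope.

(** * Free groups, as groups of reduced words *)

Section FreeGroup.
Variable X : choiceType.

(* (x, false) stands for the letter x and (x, true) for its inverse. *)
Definition letter : Type := (X * bool)%type.
Implicit Types (l : letter) (u v w : seq letter).

Definition inv_letter l : letter := (l.1, ~~ l.2).

Definition push l w :=
  if w is l' :: w' then if l' == inv_letter l then w' else l :: w else [:: l].

Definition reduce w := foldr push [::] w.

Definition reduced w := sorted (fun l l' => l' != inv_letter l) w.

Definition inv_word w := rev (map inv_letter w).

Lemma inv_letterK : involutive inv_letter.
Proof. by case=> x e; rewrite /inv_letter /= negbK. Qed.

Lemma reduced_push l w : reduced w -> reduced (push l w).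
Proof.
case: w => [|l' w] //= red_w; case: ifPn => [_|neq] /=.
  exact: path_sorted red_w.
by rewrite neq.
Qed.

Lemma reduced_foldr u w : reduced w -> reduced (foldr push w u).
Proof. by move=> red_w; elim: u => //= l u; apply: reduced_push. Qed.

Lemma pushK l w : reduced w -> push l (push (inv_letter l) w) = w.
Proof.
case: w => [|l' w] /=; first by rewrite eqxx.
rewrite inv_letterK; case: eqP => [->|_ _]; last by rewrite /= eqxx.
by case: w => [|l'' w] //= /andP[/negPf->].
Qed.

Lemma foldr_push_reduce u w : reduced w ->
  foldr push w (reduce u) = foldr push w u.
Proof.
move=> red_w; elim: u => //= l u <-; rewrite -/(reduce u).
have: reduced (reduce u) by apply: reduced_foldr.
case: (reduce u) => [|l' r] //= red_r; case: eqP => [->|_] //=.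
by rewrite pushK //; apply: reduced_foldr.
Qed.

Lemma reduce_id w : reduced w -> reduce w = w.
Proof.
elim: w => //= l w IH red_lw; rewrite (IH (path_sorted red_lw)).
by case: w red_lw {IH} => [|l' w] //= /andP[/negPf->].
Qed.

Lemma reduce_catr u v : reduce (u ++ reduce v) = reduce (u ++ v).
Proof.
by rewrite /reduce !foldr_cat -/(reduce (reduce v)) reduce_id // reduced_foldr.
Qed.

Lemma reduce_catl u v : reduce (reduce u ++ v) = reduce (u ++ v).
Proof. by rewrite /reduce !foldr_cat foldr_push_reduce // reduced_foldr. Qed.

Lemma reduce_word_inv w : reduce (w ++ inv_word w) = [::].
Proof.
elim: w => // l w IH; rewrite /inv_word /= rev_cons -cats1 -/(inv_word w).
by rewrite catA -reduce_catl IH /= eqxx.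
Qed.

Lemma inv_wordK : involutive inv_word.
Proof.
move=> w; rewrite /inv_word map_rev revK -map_comp.
by rewrite (eq_map (g := id)) ?map_id // => l; apply: inv_letterK.
Qed.

Record free_group := FreeGroup { word :> seq letter; _ : reduced word }.

HB.instance Definition _ := [isSub for word].
HB.instance Definition _ := [Choice of free_group by <:].

Implicit Types x y z : free_group.

Definition free_red w : free_group :=
  @FreeGroup (reduce w) (@reduced_foldr w [::] isT).

Definition free_mul x y := free_red (x ++ y).
Definition free_one := free_red [::].
Definition free_inv x := free_red (inv_word x).

(* The generator of the free group attached to x. *)
Definition free_gen (x : X) := free_red [:: (x, false)].

Lemma free_mulA : associative free_mul.
Proof. by move=> x y z; apply: val_inj; rewrite /= reduce_catr reduce_catl catA. Qed.

Lemma free_1mul : left_id free_one free_mul.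
Proof. by move=> x; apply: val_inj; rewrite /= reduce_id //; apply: valP. Qed.

Lemma free_mul1 : right_id free_one free_mul.
Proof.
by move=> x; apply: val_inj; rewrite /= cats0 reduce_id //; apply: valP.
Qed.

Lemma free_Vmul : left_inverse free_one free_inv free_mul.
Proof.
move=> x; apply: val_inj; rewrite /= reduce_catl.
by rewrite -[X in _ ++ X]inv_wordK reduce_word_inv.
Qed.

Lemma free_mulV : right_inverse free_one free_inv free_mul.
Proof. by move=> x; apply: val_inj; rewrite /= reduce_catr reduce_word_inv. Qed.

HB.instance Definition _ := isGroup.Build free_group
  free_mulA free_1mul free_mul1 free_Vmul free_mulV.

End FreeGroup.

(** * Quotient of a group by the normal closure of a list of elements *)

Inductive normal_closure (G : groupType) (R : seq G) : G -> Prop :=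
| NormalClosure_gen r : r \in R -> normal_closure R r
| NormalClosure_1 : normal_closure R 1
| NormalClosure_M x y :
    normal_closure R x -> normal_closure R y -> normal_closure R (x * y)
| NormalClosure_V x : normal_closure R x -> normal_closure R x^-1
| NormalClosure_J x y : normal_closure R x -> normal_closure R (x ^ y).

Section QuotientGroup.
Variables (G : groupType) (R : seq G).

Definition eqmod (x y : G) : bool := `[< normal_closure R (x^-1 * y) >].

Lemma eqmod_refl : reflexive eqmod.
Proof. by move=> x; apply/asboolP; rewrite mulVg; constructor. Qed.

Lemma eqmod_sym : symmetric eqmod.
Proof.
by move=> x y; apply/asboolP/asboolP => /NormalClosure_V; rewrite invgM invgK.
Qed.

Lemma eqmod_trans : transitive eqmod.
Proof.
move=> y x z /asboolP Nxy /asboolP Nyz; apply/asboolP.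
by have := NormalClosure_M Nxy Nyz; rewrite mulgA mulgK.
Qed.

Canonical eqmod_equiv := EquivRel eqmod eqmod_refl eqmod_sym eqmod_trans.

Definition quotient_group := {eq_quot eqmod}.
HB.instance Definition _ := Choice.on quotient_group.
HB.instance Definition _ := EqQuotient.on quotient_group.

Definition quotient_proj (x : G) : quotient_group := \pi_quotient_group x.

Definition quotient_mul (x y : quotient_group) :=
  quotient_proj (repr x * repr y).
Definition quotient_one := quotient_proj 1.
Definition quotient_inv (x : quotient_group) := quotient_proj (repr x)^-1.

Lemma quotient_projP x y :
  quotient_proj x = quotient_proj y <-> normal_closure R (x^-1 * y).
Proof.
split=> [/eqP|Nxy]; last by apply/eqP; rewrite eqmodE; apply/asboolP.
by rewrite eqmodE => /asboolP.
Qed.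

Lemma quotient_repr x : normal_closure R ((repr (quotient_proj x))^-1 * x).
Proof. by apply/quotient_projP; apply: reprK. Qed.

Lemma quotient_projM x y :
  quotient_mul (quotient_proj x) (quotient_proj y) = quotient_proj (x * y).
Proof.
apply/quotient_projP; set x' := repr _; set y' := repr _.
have Nx : normal_closure R (x'^-1 * x) by apply: quotient_repr.
have Ny : normal_closure R (y'^-1 * y) by apply: quotient_repr.
have -> : (x' * y')^-1 * (x * y) = (x'^-1 * x) ^ y' * (y'^-1 * y).
  by rewrite /conjg invgM !mulgA mulgK.
by apply: NormalClosure_M => //; apply: NormalClosure_J.
Qed.

Lemma quotient_projV x : quotient_inv (quotient_proj x) = quotient_proj x^-1.
Proof.
apply/quotient_projP; set x' := repr _; rewrite invgK.
have Nx : normal_closure R (x'^-1 * x) by apply: quotient_repr.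
have -> : x' * x^-1 = ((x'^-1 * x)^-1) ^ x'^-1.
  by rewrite /conjg invgM !invgK !mulgA mulgK.
by apply: NormalClosure_J; apply: NormalClosure_V.
Qed.

Lemma quotient_projK x : quotient_proj (repr x) = x.
Proof. exact: reprK. Qed.

Lemma quotient_mulA : associative quotient_mul.
Proof.
move=> x y z; rewrite -[x]quotient_projK -[y]quotient_projK -[z]quotient_projK.
by rewrite !quotient_projM mulgA.
Qed.

Lemma quotient_1mul : left_id quotient_one quotient_mul.
Proof. by move=> x; rewrite -[x]quotient_projK quotient_projM mul1g. Qed.

Lemma quotient_mul1 : right_id quotient_one quotient_mul.
Proof. by move=> x; rewrite -[x]quotient_projK quotient_projM mulg1. Qed.

Lemma quotient_Vmul : left_inverse quotient_one quotient_inv quotient_mul.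
Proof.
by move=> x; rewrite -[x]quotient_projK quotient_projV quotient_projM mulVg.
Qed.

Lemma quotient_mulV : right_inverse quotient_one quotient_inv quotient_mul.
Proof.
by move=> x; rewrite -[x]quotient_projK quotient_projV quotient_projM mulgV.
Qed.

HB.instance Definition _ := isGroup.Build quotient_group
  quotient_mulA quotient_1mul quotient_mul1 quotient_Vmul quotient_mulV.

End QuotientGroup.

(** * The special linear groups *)

Section SpecialLinear.
Local Open Scope ring_scope.
Variables (n : nat) (A : comNzRingType).

Record SL := MkSL { SLval :> 'M[A]_n; _ : \det SLval == 1 }.

HB.instance Definition _ := [isSub for SLval].
HB.instance Definition _ := [Choice of SL by <:].

Implicit Types x y z : SL.

Lemma det_SL x : \det x = 1.
Proof. by case: x => M /= /eqP. Qed.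

Lemma SL_mul_subproof x y : \det (x *m y) == 1.
Proof. by rewrite det_mulmx !det_SL mulr1. Qed.

Lemma SL_one_subproof : \det (1%:M : 'M[A]_n) == 1.
Proof. by rewrite det1. Qed.

(* The adjugate is the inverse, the determinant being 1. *)
Lemma SL_inv_subproof x : \det (\adj x) == 1.
Proof.
have := congr1 determinant (mul_mx_adj x).
by rewrite det_mulmx det_SL mul1r det1 => ->.
Qed.

Definition SL_mul x y := MkSL (SL_mul_subproof x y).
Definition SL_one := MkSL SL_one_subproof.
Definition SL_inv x := MkSL (SL_inv_subproof x).

Lemma SL_mulA : associative SL_mul.
Proof. by move=> x y z; apply: val_inj; apply: mulmxA. Qed.

Lemma SL_1mul : left_id SL_one SL_mul.
Proof. by move=> x; apply: val_inj; apply: mul1mx. Qed.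

Lemma SL_mul1 : right_id SL_one SL_mul.
Proof. by move=> x; apply: val_inj; apply: mulmx1. Qed.

Lemma SL_Vmul : left_inverse SL_one SL_inv SL_mul.
Proof. by move=> x; apply: val_inj; rewrite /= mul_adj_mx det_SL. Qed.

Lemma SL_mulV : right_inverse SL_one SL_inv SL_mul.
Proof. by move=> x; apply: val_inj; rewrite /= mul_mx_adj det_SL. Qed.

HB.instance Definition _ := isGroup.Build SL
  SL_mulA SL_1mul SL_mul1 SL_Vmul SL_mulV.

End SpecialLinear.

(** * The words tau and the relations *)

(* All indices below are natural numbers in {1, ..., n}. *)
Section Relations.
Variables (n : nat) (G : groupType) (a b : G).

(* tau_lower d j is tau_{j+d, j}; the value at d = 0 is irrelevant. *)
Fixpoint tau_lower (d j : nat) : G :=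
  match d with
  | 0 => 1
  | 1 => a ^- j.-1 * b * a ^+ j.-1
  | d'.+1 => [~ tau_lower d' j.+1, a ^- j.-1 * b * a ^+ j.-1]
  end.

(* The exponent (-1)^(n-1) is 1 or -1 according to the parity of n. *)
Definition tau_1n : G :=
  let t := a ^- n.-1 * b * a ^+ n.-1 in if odd n then t else t^-1.

Definition tau_last (i : nat) : G :=
  if i == 1%N then tau_1n else [~ tau_lower i.-1 1, tau_1n].

(* Only the values with i != j are meaningful. *)
Definition tau (i j : nat) : G :=
  if j < i then tau_lower (i - j) j
  else if j == n then tau_last i
  else [~ tau_last i, tau_lower (n - j) j].

Definition weyl (i : nat) : G := tau i i.+1 * (tau i.+1 i)^-1 * tau i i.+1.

Definition index_pairs : seq (nat * nat) :=
  [seq p <- [seq (i, j) | i <- iota 1 n, j <- iota 1 n] | p.1 != p.2].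

Definition commuting_pairs : seq ((nat * nat) * (nat * nat)) :=
  [seq pq <- [seq (p, q) | p <- index_pairs, q <- index_pairs] |
    [&& pq.1 != pq.2, pq.1.1 != pq.2.2 & pq.1.2 != pq.2.1]].

Definition index_triples : seq (nat * nat * nat) :=
  [seq t <- [seq (p, k) | p <- index_pairs, k <- iota 1 n] |
    (t.1.1 != t.2) && (t.1.2 != t.2)].

(* A relation U = V is the pair (U, V).  The boolean relation o selects which
   of the (ordered) pairs of index pairs are kept in the commuting family. *)
Definition relations (o : rel (nat * nat)) : seq (G * G) :=
  [seq ([~ tau pq.1.1 pq.1.2, tau pq.2.1 pq.2.2], 1)
    | pq <- commuting_pairs & o pq.1 pq.2] ++
  [seq ([~ tau t.1.1 t.1.2, tau t.1.2 t.2], tau t.1.1 t.2)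
    | t <- index_triples] ++
  [:: ((tau 1 2 * (tau 2 1)^-1 * tau 1 2) ^+ 4, 1);
      (a, \big[*%g/1]_(i <- rev (iota 1 n.-1)) weyl i)].

Definition relators (o : rel (nat * nat)) : seq G :=
  [seq r.1 * r.2^-1 | r <- relations o].

End Relations.

(* o keeps exactly one of (p, q) and (q, p) whenever p != q. *)
Definition orientation (o : rel (nat * nat)) : Prop :=
  forall p q, p != q -> o p q (+) o q p.

(** * The presentation *)

(* The generators a and b of the free group of rank two. *)
Definition gen_a : free_group bool := free_gen false.
Definition gen_b : free_group bool := free_gen true.

(* The standard n x n matrix unit, with indices i and j starting from 1. *)
Definition mx_unit (n i j : nat) : 'M[int]_n :=
  (\matrix_(k < n, l < n) ((k.+1 == i) && (l.+1 == j))%:R)%R.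

Definition mx_a (n : nat) : 'M[int]_n :=
  ((\sum_(1 <= i < n) mx_unit n i i.+1) + (-1) ^+ n.-1 *: mx_unit n n 1)%R.

Definition mx_b (n : nat) : 'M[int]_n := (1%:M + mx_unit n 2 1)%R.

(* SL_n(Z) is isomorphic to < a, b | R >, with a and b corresponding to the
   matrices mx_a n and mx_b n. *)
Definition presents_SLZ (n : nat) (R : seq (free_group bool)) : Prop :=
  exists f : {multiplicative quotient_group R -> SL n int},
    [/\ bijective f,
        SLval (f (quotient_proj R gen_a)) = mx_a n
      & SLval (f (quotient_proj R gen_b)) = mx_b n].

(* Main.v *)
From HB Require Import structures.
Require Import Defs.
From mathcomp Require Import all_boot all_order all_algebra.
From mathcomp Require Import zify.

Set Implicit Arguments.
Unset Strict Implicit.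
Unset Printing Implicit Defensive.

Import GRing.Theory Num.Theory.

(** The relations make the words tau_ij into elements x_ij that satisfy the
    Steinberg relations, with w_12 ^ 4 = 1 for w_ij = x_ij x_ji^-1 x_ij, and
    the last relation together with b = tau_21 shows that the x_ij generate
    the presented group G.  Sending a and b to the two given matrices sends
    tau_ij to the elementary matrix 1 + E_ij ([tauE], [tau_SL]), so all
    relations hold in SL_n(Z) and there is a homomorphism f from G to
    SL_n(Z); it is onto because elementary matrices generate SL_n(Z)
    ([elem_generate]).

    The substance is the injectivity of f ([faithful]), which amounts to
    the Steinberg presentation of SL_n(Z) by elementary matrices, proved with
    Silvester's norm argument.  Let G act on Z^n from the right through f,
    and measure g by the l1-norm N g of the row e_k f(g).  The elements w_ij
    act as signed permutations, preserve N and permute the x_ij^{+-1} by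
    conjugation.  A word in the x_ij traces a path of norms.  A descent at
    its end forms a peak with the step before it, and a peak can be bypassed:
    if two steps x, u lead from q to norms at most N q, the first one strictly
    smaller, then q u and q x are joined by steps x_ij^{+-1} and w_ij that
    stay strictly below N q ([peak]).  Each case of that lemma is an identity
    in the Steinberg group and an inequality between absolute values of three
    or four integers.  Hence every g is a product along which N never
    decreases at an x_ij-step ([words_ascending]).

    If moreover f(g) fixes e_k then N stays equal to 1 along such a product,
    so each x-step, once the w's are moved to its right, fixes e_k already.
    What remains are the w's themselves; they are handled by the cosets
    that correspond to the vectors +-e_j, and only here w_12 ^ 4 = 1 is used.
    Therefore the stabilizer of e_k in the subgroup of the indices at most k
    is generated by the x_ij with i <> k ([stabilizer]).  Such an element is
    the product of one with indices less than k and one of the abelian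
    subgroup of the x_ik, on which f is visibly faithful; induction on k
    concludes.

    For the count, the commutativity relation is symmetric in its two index
    pairs, so an orientation keeps exactly half of the ordered ones: of these
    there are n(n-1) * (n-1)(n-2), next to n(n-1)(n-2) triples and two further
    relations. *)

(** * Products of elements of a set *)

Section Words.
Local Open Scope group_scope.
Variable G : groupType.

Inductive words (A : G -> Prop) : G -> Prop :=
| words1 : words A 1
| wordsM g y : words A g -> A y -> words A (g * y).

Lemma words_gen (A : G -> Prop) y : A y -> words A y.
Proof. by move=> Ay; rewrite -[y]mul1g; apply: wordsM => //; apply: words1. Qed.

Lemma words_mul (A : G -> Prop) g h : words A g -> words A h -> words A (g * h).
Proof.
move=> Ag; elim=> [|h' y _ IH Ay]; first by rewrite mulg1.
by rewrite mulgA; apply: wordsM.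
Qed.

Lemma words_inv (A : G -> Prop) :
  (forall y, A y -> A y^-1) -> forall g, words A g -> words A g^-1.
Proof.
move=> AV g; elim=> [|h y _ IH Ay]; first by rewrite invg1; apply: words1.
by rewrite invgM; apply: words_mul => //; apply/words_gen/AV.
Qed.

End Words.

(** * Signed generators and their effect on a row *)

Section SLTheory.
Variables (n : nat) (A : comNzRingType).
Lemma SLM (g h : SL n A) : SLval (g * h)%g = (SLval g *m SLval h)%R.
Proof. by []. Qed.
Lemma SL1 : SLval (1%g : SL n A) = 1%:M%R.
Proof. by []. Qed.
End SLTheory.

Ltac neq_sym := by rewrite // eq_sym.

Section SignedGenerators.
Local Open Scope group_scope.
Variables (n : nat) (G : groupType) (x : 'I_n -> 'I_n -> G).
Implicit Types (i j k l a b : 'I_n) (s t : bool).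

(** The flag [s] is the sign of the exponent: [true] stands for the inverse. *)
Definition xsgn i j s : G := if s then (x i j)^-1 else x i j.

Arguments xsgn : simpl never.
Local Notation X := xsgn.

Lemma xsgnV i j s : (X i j s)^-1 = X i j (~~ s).
Proof. by case: s; rewrite /xsgn ?invgK. Qed.

Lemma xsgnK i j s : X i j s * X i j (~~ s) = 1.
Proof. by rewrite -xsgnV mulgV. Qed.

Lemma xsgnKV i j s : X i j (~~ s) * X i j s = 1.
Proof. by rewrite -xsgnV mulVg. Qed.

(** For [s = false] this is the usual w_ij of the Steinberg group, which maps to
    the block with rows (0, 1) and (-1, 0); for [s = true] it is its inverse. *)
Definition wsgn i j s : G := X i j s * X j i (~~ s) * X i j s.
Local Notation w := wsgn.

Lemma wsgnV i j s : (w i j s)^-1 = w i j (~~ s).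
Proof. by rewrite /wsgn !invgM !xsgnV !negbK !mulgA. Qed.

Section Rows.
Variable f : UMagmaMorphism.type G (SL n int).
Hypothesis f_x : forall i j, i != j -> SLval (f (x i j)) = (1%:M + delta_mx i j)%R.
Variable k : 'I_n.

Definition row_entry (g : G) (l : 'I_n) : int := SLval (f g) k l.
Definition signed (s : bool) (z : int) : int := if s then (- z)%R else z.
Definition row_norm (g : G) : nat := \sum_l `|row_entry g l|%N.
Local Notation v := row_entry.
Local Notation N := row_norm.

Lemma SLval_xsgn i j s : i != j ->
  SLval (f (X i j s)) = (1%:M + signed s 1 *: delta_mx i j)%R.
Proof.
move=> ij; case: s; rewrite /xsgn /signed; last by rewrite f_x // scale1r.
rewrite gmulfV.
have E : ((1%:M + delta_mx i j) *m (1%:M + -1 *: delta_mx i j) = 1%:M :> 'M[int]_n)%R.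
  rewrite mulmxDl !mulmxDr !mul1mx mulmx1 -scalemxAr mul_delta_mx_0; last neq_sym.
  by rewrite scaler0 addr0 -addrA scaleN1r addNr addr0.
rewrite -f_x // in E.
have EV : (SLval (f (x i j))^-1%g *m SLval (f (x i j)) = 1%:M)%R.
  by rewrite -SLM mulVg.
by rewrite -[LHS]mulmx1 -[X in (_ *m X)%R]E mulmxA EV mul1mx.
Qed.

Lemma row_entry_mulx g i j s l : i != j ->
  v (g * X i j s) l = (v g l + signed s (v g i *+ (l == j)))%R.
Proof.
move=> ij; rewrite /row_entry gmulfM /= SLval_xsgn // mulmxDr mulmx1 mxE; congr (_ + _)%R.
rewrite -scalemxAr mxE mxE (bigD1 i) //= big1 ?addr0; last first.
  by move=> m /negPf mi; rewrite mxE mi mulr0.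
by rewrite mxE eqxx /= mulr_natr; case: s => /=; rewrite ?mulN1r ?mul1r.
Qed.

Lemma row_entry_mulx_at g i j s : i != j -> v (g * X i j s) j = (v g j + signed s (v g i))%R.
Proof. by move=> ij; rewrite row_entry_mulx // eqxx. Qed.

Lemma row_entry_mulx_off g i j s l : i != j -> l != j -> v (g * X i j s) l = v g l.
Proof. by move=> ij /negPf lj; rewrite row_entry_mulx // lj; case: s; rewrite /= ?oppr0 addr0. Qed.

Lemma row_norm_mulx g i j s : i != j ->
  N (g * X i j s) + `|v g j|%N = N g + `|(v g j + signed s (v g i))%R|%N.
Proof.
move=> ij; rewrite /row_norm (bigD1 j) //= [\sum_l _](bigD1 j) //= row_entry_mulx_at //.
rewrite (eq_bigr (fun l => `|v g l|%N)); first by lia.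
by move=> l lj; rewrite row_entry_mulx_off.
Qed.

(** The three facts about one step along a path, in the form in which they are
    fed to linear arithmetic. *)
Lemma row_mulx g i j s : i != j ->
  [/\ N (g * X i j s) + `|v g j|%N = N g + `|(v g j + signed s (v g i))%R|%N,
      v (g * X i j s) j = (v g j + signed s (v g i))%R &
      forall l, l != j -> v (g * X i j s) l = v g l].
Proof.
by move=> ij; split=> [||l];
  [exact: row_norm_mulx | exact: row_entry_mulx_at | exact: row_entry_mulx_off].
Qed.

Lemma row_norm_mulw g i j s : i != j -> N (g * w i j s) = N g.
Proof.
move=> ij; have ji : j != i by neq_sym.
rewrite /wsgn !mulgA.
have [] := row_mulx g s ij; move: (g * _) => g1 E1 F1 /(_ _ ij) O1.
have [] := row_mulx g1 (~~ s) ji; move: (g1 * _) => g2 E2 F2 /(_ _ ji) O2.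
have [] := row_mulx g2 s ij; move: (g2 * _) => g3 E3 F3 /(_ _ ij) O3.
by case: s E1 F1 E2 F2 E3 F3 => /=; lia.
Qed.

Lemma row_entry1 l : v 1 l = (k == l)%:R%R.
Proof. by rewrite /row_entry gmulf1 SL1 mxE. Qed.

Lemma row_norm1 : N 1 = 1%N.
Proof.
rewrite /row_norm (bigD1 k) //= row_entry1 eqxx big1 // => l lk.
by rewrite row_entry1 eq_sym (negPf lk).
Qed.

(** A row of an invertible matrix does not vanish. *)
Lemma row_norm_gt0 g : 0 < N g.
Proof.
rewrite lt0n; apply/negP; rewrite sum_nat_eq0 => /forallP N0.
have : (SLval (f g) *m SLval (f g^-1%g))%R k k = 0%R.
  rewrite mxE big1 // => l _; have := N0 l.
  by rewrite -[SLval (f g) k l]/(v g l) absz_eq0 => /eqP->; rewrite mul0r.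
by rewrite -SLM -gmulfM mulgV gmulf1 SL1 mxE eqxx.
Qed.

Lemma row_entry_fixl p h l : (forall l', v p l' = v 1 l') -> v (p * h) l = v h l.
Proof.
move=> vp; rewrite -[in RHS](mul1g h) /row_entry !gmulfM !SLM !mxE.
by apply: eq_bigr => l' _; rewrite -/(v p l') vp.
Qed.

Lemma row_entry_mulw g i j s : i != j ->
  v (g * w i j s) i = signed (~~ s) (v g j) /\ v (g * w i j s) j = signed s (v g i).
Proof.
move=> ij; have ji : j != i by neq_sym.
rewrite /wsgn !mulgA.
have [] := row_mulx g s ij; move: (g * _) => g1 E1 F1 /(_ _ ij) O1.
have [] := row_mulx g1 (~~ s) ji; move: (g1 * _) => g2 E2 F2 /(_ _ ji) O2.
have [] := row_mulx g2 s ij; move: (g2 * _) => g3 E3 F3 /(_ _ ij) O3.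
by case: s E1 F1 E2 F2 E3 F3 => /=; lia.
Qed.

Lemma row_entry_mulw_off g i j s l : i != j -> l != i -> l != j ->
  v (g * w i j s) l = v g l.
Proof.
move=> ij li lj; have ji : j != i by neq_sym.
by rewrite /wsgn !mulgA !row_entry_mulx_off.
Qed.

End Rows.
End SignedGenerators.
Arguments xsgn : simpl never.

(** Closes an inequality between norms that depends on the two signs [s] and [t];
    the hypotheses that matter are first moved to the goal. *)
Ltac signs s t := clear -s t; move=> *; destruct s, t; simpl in *; lia.

(** * Consequences of the Steinberg relations *)

Section SteinbergCalculus.
Local Open Scope group_scope.
Variables (n : nat) (G : groupType) (x : 'I_n -> 'I_n -> G).
Local Notation X := (xsgn x).
Local Notation w := (wsgn x).
Hypothesis n_ge3 : 2 < n.
Hypothesis x_comm : forall i j k l, i != j -> k != l -> i != l -> j != k ->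
  commute (x i j) (x k l).
Hypothesis x_commg : forall i j k, i != j -> j != k -> i != k ->
  [~ x i j, x j k] = x i k.
Implicit Types (i j k l a b : 'I_n) (s t : bool).

Lemma xsgn_comm i j s k l t : i != j -> k != l -> i != l -> j != k ->
  commute (X i j s) (X k l t).
Proof.
move=> ij kl il jk; have C := x_comm ij kl il jk.
have CV : commute (x i j) (X k l t) by case: t; [exact: commuteV | exact: C].
by case: s; [apply/commute_sym/commuteV/commute_sym | exact: CV].
Qed.

Lemma xsgnJ_comm i j s k l t : i != j -> k != l -> i != l -> j != k ->
  X i j s ^ X k l t = X i j s.
Proof. by move=> ij kl il jk; rewrite /conjg xsgn_comm // mulKg. Qed.

(** The Steinberg relation for all four choices of signs, in the form of
    conjugations; the signs multiply, as they do for the matrices. *)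
Lemma xsgnJ_target i j k s t : i != j -> j != k -> i != k ->
  X i j s ^ X j k t = X i j s * X i k (s (+) t).
Proof.
move=> ij jk ik; have E0 : x i j ^ x j k = x i j * x i k.
  by rewrite -(x_commg ij jk ik) /commg mulgA mulgV mul1g.
have Cjk : x i k ^ x j k = x i k by apply: (xsgnJ_comm false false); rewrite // eq_sym.
have E1 : x i j ^ (x j k)^-1 = x i j * (x i k)^-1.
  apply: (@conjg_inj _ (x j k)); rewrite conjgKV conjMg conjVg E0 Cjk.
  by rewrite mulgK.
have Cij t' : commute (x i j) (X i k t') by apply: (xsgn_comm false _); rewrite // eq_sym.
case: s t => [] []; rewrite /xsgn //= ?conjVg ?E0 ?E1 ?invgM ?invgK.
  by rewrite -(commuteV (commute_sym (Cij false))).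
by have /commute_sym/commuteV <- := Cij true.
Qed.

Lemma xsgnJ_source i j k s t : i != j -> j != k -> i != k ->
  X j k t ^ X i j s = X j k t * X i k (~~ (s (+) t)).
Proof.
move=> ij jk ik; have E : X i j s * X j k t * (X i k (s (+) t))^-1 = X j k t * X i j s.
  by rewrite [_ * X j k t]conjgC xsgnJ_target // !mulgA mulgK.
by rewrite /conjg -E -xsgnV !mulgA mulVg mul1g.
Qed.

(** Conjugation by w_ij acts on the x_kl^{+-1} through the signed permutation
    i -> j, j -> -i of the indices.  The next lemmas treat the positions of k
    and l relative to i and j; as long as one of k, l lies outside {i, j} they
    follow by conjugating with the three factors of w_ij in turn. *)
Lemma xsgnJw_fix i j k l s t : i != j -> k != l ->
  k != i -> k != j -> l != i -> l != j -> X k l t ^ w i j s = X k l t.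
Proof. by move=> ij kl ki kj li lj; rewrite /wsgn !conjgM !xsgnJ_comm //; neq_sym. Qed.

Lemma xsgnJw_source1 i j l s t : i != j -> i != l -> j != l ->
  X i l t ^ w i j s = X j l (t (+) s).
Proof.
move=> ij il jl; have ji : j != i by neq_sym.
have li : l != i by neq_sym. have lj : l != j by neq_sym.
rewrite /wsgn !conjgM (xsgnJ_comm t s) // xsgnJ_source // conjMg xsgnJ_comm // xsgnJ_source //.
rewrite (xsgn_comm _ _ jl il jl li) //.
by case: s t => [] [] /=; rewrite mulgA ?xsgnK ?xsgnKV mul1g.
Qed.

Lemma xsgnJw_source2 i j l s t : i != j -> i != l -> j != l ->
  X j l t ^ w i j s = X i l (~~ (t (+) s)).
Proof.
move=> ij il jl; have ji : j != i by neq_sym.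
have li : l != i by neq_sym. have lj : l != j by neq_sym.
rewrite /wsgn !conjgM xsgnJ_source // conjMg xsgnJ_comm // xsgnJ_source //.
rewrite (xsgn_comm _ _ il jl il lj) // mulgA.
have -> : ~~ (~~ s (+) ~~ (s (+) t)) = ~~ t by case: s t => [] [].
by rewrite xsgnK mul1g xsgnJ_comm // addbC.
Qed.

Lemma xsgnJw_target1 i j k s t : i != j -> k != i -> k != j ->
  X k i t ^ w i j s = X k j (t (+) s).
Proof.
move=> ij ki kj; have ji : j != i by neq_sym.
have ik : i != k by neq_sym. have jk : j != k by neq_sym.
rewrite /wsgn !conjgM xsgnJ_target // conjMg xsgnJ_comm // xsgnJ_target //.
have -> : t (+) s (+) ~~ s = ~~ t by case: s t => [] [].
by rewrite (xsgn_comm _ _ kj ki ki jk) // mulgA xsgnK mul1g xsgnJ_comm.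
Qed.

Lemma xsgnJw_target2 i j k s t : i != j -> k != i -> k != j ->
  X k j t ^ w i j s = X k i (~~ (t (+) s)).
Proof.
move=> ij ki kj; have ji : j != i by neq_sym.
have ik : i != k by neq_sym. have jk : j != k by neq_sym.
rewrite /wsgn !conjgM (xsgnJ_comm t s) // xsgnJ_target // conjMg xsgnJ_comm // xsgnJ_target //.
rewrite (xsgn_comm _ _ ki kj kj ik) // mulgA.
have -> : t (+) ~~ s (+) s = ~~ t by case: s t => [] [].
by rewrite xsgnK mul1g addbN.
Qed.

Lemma exists_third i j : exists m : 'I_n, i != m /\ j != m.
Proof.
have /subsetPn[m _ mP] : ~~ ([set: 'I_n] \subset [set i; j]).
  apply: contraTN n_ge3 => /subset_leq_card; rewrite cardsT card_ord cards2.
  by case: eqP => _ H; rewrite -leqNgt //; apply: leq_trans H _.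
by move: mP; rewrite !inE negb_or => /andP[mi mj]; exists m; split; neq_sym.
Qed.

Lemma xsgn_commg i j k s t : i != j -> j != k -> i != k ->
  [~ X i j s, X j k t] = X i k (s (+) t).
Proof. by move=> ij jk ik; rewrite commgEl xsgnJ_target // mulKg. Qed.

(** For {k, l} = {i, j} one writes x_ij as the commutator of x_im and x_mj with a
    third index m, whose conjugates are already known; this is where n >= 3
    is needed. *)
Lemma xsgnJw_self i j s t : i != j -> X i j t ^ w i j s = X j i (~~ t).
Proof.
move=> ij; have [m [im jm]] := exists_third i j.
have mj : m != j by neq_sym. have mi : m != i by neq_sym. have ji : j != i by neq_sym.
have XE : X i j t = [~ X i m t, X m j false] by rewrite xsgn_commg // addbF.
rewrite XE conjRg xsgnJw_source1 // xsgnJw_target2 // xsgn_commg //.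
by case: s t {XE} => [] [].
Qed.

Lemma xsgnJw_opp i j s t : i != j -> X j i t ^ w i j s = X i j (~~ t).
Proof.
move=> ij; have [m [im jm]] := exists_third i j.
have mj : m != j by neq_sym. have mi : m != i by neq_sym. have ji : j != i by neq_sym.
have XE : X j i t = [~ X j m t, X m i false] by rewrite xsgn_commg // addbF.
rewrite XE conjRg xsgnJw_source2 // xsgnJw_target1 // xsgn_commg //.
by case: s t {XE} => [] [].
Qed.

(** Conjugating w_ij by itself replaces x_ij by x_ji^-1 and x_ji by x_ij^-1. *)
Lemma wsgn_sym i j s : i != j -> w i j s = w j i (~~ s).
Proof.
move=> ij; have <- : w i j s ^ w i j s = w i j s by rewrite /conjg mulKg.
by rewrite {1}/wsgn /wsgn !conjMg xsgnJw_self // xsgnJw_opp // negbK.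
Qed.

(** The form in which the conjugation rules are used when only the fact that the
    signed generators are permuted matters; the bound [m] records that no new
    index appears. *)
Lemma xsgnJw i j k l s t : i != j -> k != l ->
  exists k' l' t', [/\ k' != l', X k l t ^ w i j s = X k' l' t' &
    forall m : nat, i < m -> j < m -> k < m -> l < m -> k' < m /\ l' < m].
Proof.
move=> ij kl; have ji : j != i by neq_sym.
have [ki|ki] := eqVneq k i; have [lj|lj] := eqVneq l j; subst.
- by exists j, i, (~~ t); split=> //; apply: xsgnJw_self.
- exists j, l, (t (+) s); split=> //; first neq_sym.
  by apply: xsgnJw_source1; rewrite // eq_sym.
- have [ki'|] := eqVneq k j; first by rewrite ki' eqxx in kl.
  by exists k, i, (~~ (t (+) s)); split=> //; apply: xsgnJw_target2.
have [kj|kj] := eqVneq k j; have [li|li] := eqVneq l i; subst.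
- by exists i, j, (~~ t); split=> //; apply: xsgnJw_opp.
- exists i, l, (~~ (t (+) s)); split=> //; first neq_sym.
  by apply: xsgnJw_source2; rewrite // eq_sym.
- by exists k, j, (t (+) s); split=> //; apply: xsgnJw_target1.
by exists k, l, t; split=> //; apply: xsgnJw_fix.
Qed.

Lemma wsgnJ_source i j l s t : i != j -> i != l -> j != l ->
  w i l t ^ w i j s = w j l (t (+) s).
Proof.
move=> ij il jl; rewrite /wsgn !conjMg xsgnJw_source1 // xsgnJw_target1 //; try neq_sym.
by rewrite addNb.
Qed.

Lemma wsgnJ_target i j l s t : i != j -> l != i -> l != j ->
  w l i t ^ w i j s = w l j (t (+) s).
Proof.
move=> ij il jl; rewrite /wsgn !conjMg xsgnJw_source1 // ?xsgnJw_target1 //; try neq_sym.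
by rewrite addNb.
Qed.

Lemma wsgnJ_fix i j k l s t : i != j -> k != l ->
  k != i -> k != j -> l != i -> l != j -> w k l t ^ w i j s = w k l t.
Proof. by move=> ij kl ki kj li lj; rewrite /wsgn !conjMg !xsgnJw_fix //; neq_sym. Qed.

Section OrderFour.
Variables i0 j0 : 'I_n.
Hypothesis ij0 : i0 != j0.
Hypothesis w4 : w i0 j0 false ^+ 4 = 1.

(** All w_ij^{+-1} are conjugate. *)
Lemma wsgn_order4 i j s : i != j -> w i j s ^+ 4 = 1.
Proof.
move=> ij; suff w4f : w i j false ^+ 4 = 1.
  by case: s => //; rewrite -[true]/(~~ false) -wsgnV expVgn w4f invg1.
have w4i k : i0 != k -> w i0 k false ^+ 4 = 1.
  have [<-//|jk ik] := eqVneq j0 k.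
  by rewrite -[false]/(false (+) false) -(wsgnJ_target _ _ jk) // -conjXg w4 conj1g.
have [ji0|ii] := eqVneq j i0.
  by rewrite ji0 in ij *; rewrite wsgn_sym // -wsgnV expVgn w4i ?invg1 // eq_sym.
have [ii0|ki] := eqVneq i0 i; first by rewrite -ii0 in ij *; apply: w4i.
rewrite -[false]/(false (+) false) -(wsgnJ_source false false ki _ ij) //; last neq_sym.
by rewrite -conjXg w4i ?conj1g // eq_sym.
Qed.

Lemma wsgn_sq i j s t : i != j -> w i j s * w i j s = w i j t * w i j t.
Proof.
move=> ij; have := wsgn_order4 false ij; rewrite (expgnDr _ 2 2) => E.
have E' : w i j true * w i j true = w i j false * w i j false.
  rewrite -[true]/(~~ false) -wsgnV -invgM; apply: (mulgI (w i j false * w i j false)).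
  by rewrite mulgV E.
by case: s t => [] [].
Qed.

(** The squares h_ij of the w_ij multiply like diagonal matrices with two entries
    -1.  Conjugation by h_ij inverts w_jl, while conjugation by w_jl turns h_ij
    into h_il; comparing the two gives h_ij = h_jl h_il. *)
Lemma wsgn_sq_mul i j l s t r : i != j -> i != l -> j != l ->
  w i j s * w i j s = (w j l t * w j l t) * (w i l r * w i l r).
Proof.
move=> ij il jl; have ji : j != i by neq_sym.
have li : l != i by neq_sym. have lj : l != j by neq_sym.
set h := w i j s * w i j s; set W := w j l t.
have hW : W ^ h = W^-1.
  rewrite /h conjgM {1}(wsgn_sym s ij) /W wsgnJ_source // wsgnJ_source // wsgnV.
  by case: s t {h W} => [] [].
have -> : w i l r * w i l r = h ^ W.
  by rewrite /h conjMg /W wsgnJ_target //; apply: wsgn_sq.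
have hW' : h * W = W^-1 * h by rewrite [RHS]conjgC conjVg hW invgK.
by clearbody h W; rewrite /conjg hW' !mulgA mulgK mulgV mul1g.
Qed.

(** * Silvester's norm argument *)

Section Norm.
Variable f : UMagmaMorphism.type G (SL n int).
Hypothesis f_x : forall i j, i != j -> SLval (f (x i j)) = (1%:M + delta_mx i j)%R.
Variable k : 'I_n.

Local Notation v := (row_entry f k).
Local Notation N := (row_norm f k).

(** In this section [q] is the top of a peak with the two legs [q * X a b t] and
    [q * X i j s], of which the second leads strictly down.  Connecting the feet
    below the level of [q] is expressed with a predicate [S] that is closed under
    steps ending below that level, and under multiplication by the norm
    preserving w_ij.  In the comments c_l is the l-th entry of the row of [q]. *)
Section Peak.
Variables (m : nat) (S : G -> Prop) (q : G).
Hypothesis SX : forall g i j s, i < m -> j < m -> i != j ->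
  S g -> N (g * X i j s) < N q -> S (g * X i j s).
Hypothesis Sw : forall g i j s, i < m -> j < m -> i != j ->
  S g -> S (g * w i j s).

(** The two steps commute and their effects on the norm do not interfere, so one
    goes around the square of the two steps. *)
Lemma peak_square i j s a b t :
  i < m -> j < m -> i != j -> a < m -> b < m -> a != b ->
  i != b -> j != a -> (j != b) || (v q a == 0%R) ->
  N (q * X a b t) <= N q -> N (q * X i j s) < N q ->
  S (q * X a b t) -> S (q * X i j s).
Proof.
move=> im jm ij am bm ab ib ja jb Nu Nx Su.
have [Ex Fx Ox] := row_mulx f_x k q s ij.
have [Eu Fu Ou] := row_mulx f_x k q t ab.
have C := xsgn_comm s t ij ab ib ja.
have E0 : q * X a b t * X i j s * X a b (~~ t) = q * X i j s.
  by rewrite -!mulgA [X a b t * _]mulgA -C -mulgA xsgnK mulg1.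
have Nux : N (q * X a b t * X i j s) < N q.
  have [E F O] := row_mulx f_x k (q * X a b t) s ij.
  rewrite (Ou _ ib) in E.
  have [jbE|jb'] := eqVneq j b; last first.
    by rewrite (Ou _ jb') in E; move: Ex E Eu Nu Nx; signs s t.
  rewrite jbE eqxx /= in jb; subst b; move/eqP: jb => ca0.
  by rewrite ca0 in Eu Fu; move: Eu Fu Ex E Nu Nx; signs s t.
by rewrite -E0; apply: SX; rewrite ?E0 //; apply: SX.
Qed.

(** Here both steps change the entry c_j, and doing both may overshoot.  Since the
    steps push c_j in the same direction, one of c_i, c_a can first be reduced by the
    other; a single step then leads from the value of c_j at one foot to its value at
    the other foot, after which the reduction is undone. *)
Lemma peak_same_target i j s a t :
  i < m -> j < m -> i != j -> a < m -> a != j -> a != i -> v q a != 0%R ->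
  N (q * X a j t) <= N q -> N (q * X i j s) < N q ->
  S (q * X a j t) -> S (q * X i j s).
Proof.
move=> im jm ij am aj ai ca Nu Nx Su.
have ia : i != a by neq_sym. have ja : j != a by neq_sym. have ji : j != i by neq_sym.
have [Ex Fx Ox] := row_mulx f_x k q s ij.
have [Eu Fu Ou] := row_mulx f_x k q t aj.
have Oui := Ou _ ij. have Oua := Ou _ aj.
(* the sign for which adding c_i to c_a, or c_a to c_i, subtracts absolute values *)
pose r := ~~ (s (+) t).
have [le_ia|lt_ai] := ltnP `|v q i| (2 * `|v q a|).
  have E : q * X a j t * X i a r * X a j (~~ t) * X i a (~~ r) = q * X i j s.
    have -> : r = ~~ ~~ r by rewrite negbK.
    rewrite -xsgnV negbK -!mulgA -[(X i a _)^-1 * _]/(X a j (~~ t) ^ X i a (~~ r)).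
    by rewrite xsgnJ_source // [X a j t * _]mulgA xsgnK mul1g /r; case: (s) (t) => [] [].
  have [E1 F1 O1] := row_mulx f_x k (q * X a j t) r ia.
  have [E2 F2 O2] := row_mulx f_x k (q * X a j t * X i a r) (~~ t) aj.
  have O1j := O1 _ ja. have O1i := O1 _ ia.
  have N1 : N (q * X a j t * X i a r) < N q.
    by move: Ex Eu Nx Nu Fu E1 Oui Oua le_ia ca; rewrite /r; signs s t.
  have N2 : N (q * X a j t * X i a r * X a j (~~ t)) < N q.
    by move: Ex Eu Nx Nu Fu E1 Oui Oua le_ia ca N1 F1 O1j O1i E2; rewrite /r; signs s t.
  by rewrite -E; apply: SX; rewrite ?E //; apply: SX => //; apply: SX.
have E : q * X a j t * X a i r * X i j s * X a i (~~ r) = q * X i j s.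
  have -> : r = ~~ ~~ r by rewrite negbK.
  rewrite -xsgnV negbK -!mulgA -[(X a i _)^-1 * _]/(X i j s ^ X a i (~~ r)).
  have C := xsgn_comm s (~~ t) ij aj ij ja.
  rewrite xsgnJ_source // (_ : ~~ (~~ r (+) s) = ~~ t); last by rewrite /r; case: (s) (t) => [] [].
  by rewrite C [X a j t * _]mulgA xsgnK mul1g.
have [E1 F1 O1] := row_mulx f_x k (q * X a j t) r ai.
have [E2 F2 O2] := row_mulx f_x k (q * X a j t * X a i r) s ij.
have O1j := O1 _ ji. have O1a := O1 _ ai.
have N1 : N (q * X a j t * X a i r) < N q.
  by move: Ex Eu Nx Nu Fu E1 Oui Oua lt_ai ca; rewrite /r; signs s t.
have N2 : N (q * X a j t * X a i r * X i j s) < N q.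
  by move: Ex Eu Nx Nu Fu E1 Oui Oua lt_ai ca N1 F1 O1j O1a E2; rewrite /r; signs s t.
by rewrite -E; apply: SX; rewrite ?E //; apply: SX => //; apply: SX.
Qed.

(** The step x_ij, if preceded by x_ji^-1, equals x_ij^-1 followed by w_ij. *)
Lemma peak_turn i j s t :
  i < m -> j < m -> i != j ->
  N (q * X j i t) <= N q -> N (q * X i j s) < N q ->
  S (q * X j i t) -> S (q * X i j s).
Proof.
move=> im jm ij Nu Nx Su; have ji : j != i by neq_sym.
have [Ex Fx Ox] := row_mulx f_x k q s ij.
have [Eu Fu Ou] := row_mulx f_x k q t ji.
have ts : t = s by move: Ex Eu Nx Nu; signs s t.
rewrite {t}ts in Nu Su Eu Fu Ou *.
have E : q * X j i s * X i j (~~ s) * w i j s = q * X i j s.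
  by rewrite /wsgn -!mulgA [X i j (~~ s) * _]mulgA xsgnKV mul1g [X j i s * _]mulgA xsgnK mul1g.
rewrite -E; apply: Sw => //; apply: SX => //.
by rewrite -(row_norm_mulw f_x k _ s ij) E.
Qed.

(** If |c_a| <= |c_i| then the step x_ij can be made after the other one, at the
    price of a correction by x_aj.  Otherwise the step that reduces c_a by c_i is
    available: it is joined to [q * X a i t] as in [peak_turn], and it commutes
    with x_ij. *)
Lemma peak_into_source i j s a t :
  i < m -> j < m -> i != j -> a < m -> a != i -> a != j ->
  N (q * X a i t) <= N q -> N (q * X i j s) < N q ->
  S (q * X a i t) -> S (q * X i j s).
Proof.
move=> im jm ij am ai aj Nu Nx Su; have ji : j != i by neq_sym.
have ia : i != a by neq_sym. have ja : j != a by neq_sym.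
have [Ex Fx Ox] := row_mulx f_x k q s ij.
have [Eu Fu Ou] := row_mulx f_x k q t ai.
have Ouj := Ou _ ji. have Oua := Ou _ ai.
have [le_ai|lt_ia] := leqP `|v q a| `|v q i|.
  pose r := ~~ (s (+) t).
  have E : q * X a i t * X i j s * X a j r * X a i (~~ t) = q * X i j s.
    have C := xsgn_comm r (~~ t) aj ai ai ja.
    rewrite -!mulgA C -{1}[t]negbK -xsgnV [X i j s * _]mulgA.
    rewrite [_^-1 * _]mulgA -[_^-1 * (X i j s * _)]/(X i j s ^ X a i (~~ t)) xsgnJ_source //.
    by rewrite -mulgA /r; case: (s) (t) => [] [] /=; rewrite ?xsgnK ?xsgnKV mulg1.
  have [E1 F1 O1] := row_mulx f_x k (q * X a i t) s ij.
  have [E2 F2 O2] := row_mulx f_x k (q * X a i t * X i j s) r aj.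
  have O1a := O1 _ aj.
  have N1 : N (q * X a i t * X i j s) < N q.
    by move: Ex Eu Nx Nu Fu E1 Ouj Oua le_ai; signs s t.
  have N2 : N (q * X a i t * X i j s * X a j r) < N q.
    by move: Ex Eu Nx Nu Fu E1 Ouj Oua le_ai N1 F1 O1a E2; rewrite /r; signs s t.
  by rewrite -E; apply: SX; rewrite ?E //; apply: SX => //; apply: SX.
have Ev : q * X a i t * X i a (~~ t) * w i a t = q * X i a t.
  by rewrite /wsgn -!mulgA [X i a (~~ t) * _]mulgA xsgnKV mul1g [X a i t * _]mulgA xsgnK mul1g.
have E : q * X i a t * X i j s * X i a (~~ t) = q * X i j s.
  by rewrite -!mulgA (xsgn_comm s (~~ t) ij ia ia ji) [X i a t * _]mulgA xsgnK mul1g.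
have [E1 F1 O1] := row_mulx f_x k q t ia.
have [E2 F2 O2] := row_mulx f_x k (q * X i a t) s ij.
have O1i := O1 _ ia. have O1j := O1 _ ja.
have N1 : N (q * X i a t) < N q.
  by move: Ex Eu Nx Nu E1 lt_ia; signs s t.
have N2 : N (q * X i a t * X i j s) < N q.
  by move: Ex Eu Nx Nu E1 lt_ia N1 E2 O1i O1j; signs s t.
rewrite -E; apply: SX; rewrite ?E //; apply: SX => //.
rewrite -Ev; apply: Sw => //; apply: SX => //.
by rewrite -(row_norm_mulw f_x k _ t ia) Ev.
Qed.

(** The mirror image of the previous case: either a correction by x_ib works, or,
    when |c_i| > |c_j|, the step that reduces c_i by c_j is joined to both feet. *)
Lemma peak_from_target i j s b t :
  i < m -> j < m -> i != j -> b < m -> b != i -> b != j ->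
  N (q * X j b t) <= N q -> N (q * X i j s) < N q ->
  S (q * X j b t) -> S (q * X i j s).
Proof.
move=> im jm ij bm bi bj Nu Nx Su; have ji : j != i by neq_sym.
have ib : i != b by neq_sym. have jb : j != b by neq_sym.
have [Ex Fx Ox] := row_mulx f_x k q s ij.
have [Eu Fu Ou] := row_mulx f_x k q t jb.
have Ouj := Ou _ jb. have Oui := Ou _ ib.
have [le_ij|lt_ji] := leqP `|v q i| `|v q j|.
  pose r := s (+) t.
  have E : q * X j b t * X i j s * X i b r * X j b (~~ t) = q * X i j s.
    have C := xsgn_comm r (~~ t) ib jb ib bj.
    rewrite -!mulgA C -{1}[t]negbK -xsgnV [X i j s * _]mulgA.
    rewrite [_^-1 * _]mulgA -[_^-1 * (X i j s * _)]/(X i j s ^ X j b (~~ t)) xsgnJ_target //.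
    by rewrite -mulgA /r; case: (s) (t) => [] [] /=; rewrite ?xsgnK ?xsgnKV mulg1.
  have [E1 F1 O1] := row_mulx f_x k (q * X j b t) s ij.
  have [E2 F2 O2] := row_mulx f_x k (q * X j b t * X i j s) r ib.
  have O1i := O1 _ ij. have O1b := O1 _ bj.
  have N1 : N (q * X j b t * X i j s) < N q.
    by move: Ex Eu Nx Nu Fu E1 Ouj Oui le_ij; signs s t.
  have N2 : N (q * X j b t * X i j s * X i b r) < N q.
    by move: Ex Eu Nx Nu Fu E1 Ouj Oui le_ij N1 F1 O1i O1b E2; rewrite /r; signs s t.
  by rewrite -E; apply: SX; rewrite ?E //; apply: SX => //; apply: SX.
have Ev : q * X j b t * X j i s * X j b (~~ t) = q * X j i s.
  by rewrite -!mulgA (xsgn_comm s (~~ t) ji jb jb ij) [X j b t * _]mulgA xsgnK mul1g.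
have E : q * X j i s * X i j (~~ s) * w i j s = q * X i j s.
  by rewrite /wsgn -!mulgA [X i j (~~ s) * _]mulgA xsgnKV mul1g [X j i s * _]mulgA xsgnK mul1g.
have [E1 F1 O1] := row_mulx f_x k q s ji.
have [E2 F2 O2] := row_mulx f_x k (q * X j b t) s ji.
have N1 : N (q * X j i s) < N q.
  by move: Ex Eu Nx Nu E1 lt_ji; signs s t.
have N2 : N (q * X j b t * X j i s) < N q.
  by move: Ex Eu Nx Nu E1 lt_ji N1 E2 Oui Ouj; signs s t.
rewrite -E; apply: Sw => //; apply: SX => //; last by rewrite -(row_norm_mulw f_x k _ s ij) E.
by rewrite -Ev; apply: SX; rewrite ?Ev //; apply: SX.
Qed.

Lemma peak i j s a b t :
  i < m -> j < m -> i != j -> a < m -> b < m -> a != b ->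
  N (q * X a b t) <= N q -> N (q * X i j s) < N q ->
  S (q * X a b t) -> S (q * X i j s).
Proof.
move=> im jm ij am bm ab Nu Nx Su; have ji : j != i by neq_sym.
have [bi|bi] := eqVneq b i; have [aj|aj] := eqVneq a j; subst.
- exact: (peak_turn im jm ij Nu Nx Su).
- exact: (peak_into_source im jm ij am ab aj Nu Nx Su).
- by apply: (peak_from_target im jm ij bm bi _ Nu Nx Su); neq_sym.
have ib : i != b by neq_sym. have ja : j != a by neq_sym.
have [ca0|ca] := eqVneq (v q a) 0%R.
  by apply: (peak_square im jm ij am bm ab ib ja _ Nu Nx Su); rewrite ca0 eqxx orbT.
have [bj|bj] := eqVneq b j; last first.
  by apply: (peak_square im jm ij am bm ab ib ja _ Nu Nx Su); rewrite eq_sym bj.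
subst b; have [ai|ai] := eqVneq a i; last first.
  exact: (peak_same_target im jm ij am ab ai ca Nu Nx Su).
have [Ex _ _] := row_mulx f_x k q s ij; have [Eu _ _] := row_mulx f_x k q t ab; subst a.
(* opposite signs cannot both decrease the same entry *)
suff -> : s = t by [].
by move: Ex Eu Nx Nu; signs s t.
Qed.
End Peak.

Definition corner_gens (m : nat) (y : G) : Prop :=
  exists i j s, [/\ i < m, j < m, i != j & y = X i j s].

(** Products along which the norm does not decrease.  Factors w_ij are allowed
    anywhere, so that no normal form has to be maintained. *)
Inductive ascending (m : nat) : G -> Prop :=
| ascending1 : ascending m 1
| ascending_w g i j s : i < m -> j < m -> i != j -> ascending m g -> ascending m (g * w i j s)
| ascending_x g i j s : i < m -> j < m -> i != j -> ascending m g ->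
    N g <= N (g * X i j s) -> ascending m (g * X i j s).

(** By induction on the norm, then on the ascending product.  A final factor w is
    moved past the new step; a final step that makes a peak with the new one is
    bypassed by [peak], all of whose intermediate products are ascending by one of
    the two induction hypotheses. *)
Lemma ascending_mulx (m : nat) g i j s : i < m -> j < m -> i != j ->
  ascending m g -> ascending m (g * X i j s).
Proof.
move: {2}(N g).+1 (ltnSn (N g)) => L.
elim: L g i j s => // L IH g i j s lt_gL im jm ij Mg.
elim: Mg lt_gL i j s im jm ij => {g}[|g a b t am bm ab Mg IHg|g a b t am bm ab Mg IHg le_g].
- move=> _ i j s im jm ij; apply: ascending_x => //; first exact: ascending1.
  by rewrite row_norm1 (row_norm_gt0 f).
- rewrite (row_norm_mulw f_x) // => lt_gL i j s im jm ij.
  have [i' [j' [s' [ij' E mP]]]] := xsgnJw (~~ t) s ab ij.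
  have [im' jm'] := mP _ am bm im jm.
  have -> : g * w a b t * X i j s = g * X i' j' s' * w a b t.
    by rewrite -E -wsgnV conjgE invgK -!mulgA mulVg mulg1.
  by apply: ascending_w => //; apply: IHg.
move=> lt_gL i j s im jm ij; set q := g * X a b t.
have Mq : ascending m q by apply: ascending_x.
have [|lt_x] := leqP (N q) (N (q * X i j s)); first exact: ascending_x.
have Eq : q * X a b (~~ t) = g by rewrite /q -mulgA xsgnK mulg1.
(* the second half provides the steps from the foot [g], whose norm may equal N q *)
pose S h := ascending m h /\ forall i j s, i < m -> j < m -> i != j ->
  N (h * X i j s) < N q -> ascending m (h * X i j s).
suff [] : S (q * X i j s) by [].
apply: (peak (m := m) _ _ im jm ij am bm ab (t := ~~ t)) => //; rewrite ?Eq //.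
- move=> h a' b' t' am' bm' ab' [Mh Sh] lt_h; split=> [|a2 b2 t2 am2 bm2 ab2 lt2].
    exact: Sh.
  by apply: IH => //; [apply: leq_trans lt_h _ | exact: Sh].
- move=> h a' b' t' am' bm' ab' [Mh Sh]; split=> [|a2 b2 t2 am2 bm2 ab2].
    exact: ascending_w.
  have [i' [j' [s' [ij' E mP]]]] := xsgnJw (~~ t') t2 ab' ab2.
  have [im' jm'] := mP _ am' bm' am2 bm2.
  have -> : h * w a' b' t' * X a2 b2 t2 = h * X i' j' s' * w a' b' t'.
    by rewrite -E -wsgnV conjgE invgK -!mulgA mulVg mulg1.
  by rewrite (row_norm_mulw f_x) // => lt_h; apply: ascending_w => //; apply: Sh.
split=> // a2 b2 t2 am2 bm2 ab2 _; apply: IHg => //.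
exact: leq_ltn_trans le_g lt_gL.
Qed.

Lemma words_ascending (m : nat) g : words (corner_gens m) g -> ascending m g.
Proof.
elim=> [|h y _ Mh [i [j [s [im jm ij ->]]]]]; first exact: ascending1.
exact: ascending_mulx.
Qed.

(** * The stabilizer of a row *)

(** The letters with indices at most [k] that fix the row e_k. *)
Definition affine_gens (y : G) : Prop :=
  exists i j s, [/\ i <= k, j <= k, i != j, i != k & y = X i j s].

Local Notation P := (words affine_gens).

Lemma affine_row p : P p -> forall l, v p l = v 1 l.
Proof.
elim=> // h y _ IH [i [j [s [_ _ ij ik ->]]]] l.
rewrite (row_entry_mulx f_x) // !IH !row_entry1 (eq_sym k i) (negPf ik) mul0rn.
by case: s; rewrite /= ?oppr0 addr0.
Qed.

Lemma affine_w i j s : i < k -> j < k -> i != j -> P (w i j s).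
Proof.
move=> ik jk ij.
have ne (a : 'I_n) : a < k -> a != k by move=> ak; apply: contraTneq ak => ->; rewrite ltnn.
have gP a b t : a < k -> b < k -> a != b -> P (X a b t).
  by move=> ak bk ab; apply: words_gen; exists a, b, t; split; rewrite ?ne // ltnW.
by rewrite /wsgn; apply: words_mul; [apply: words_mul|]; apply: gP; rewrite // eq_sym.
Qed.

(** Representatives of the right cosets of the stabilizer of e_k in the subgroup
    generated by the w_ij with indices at most [k]: they send e_k to e_k, +-e_j and
    -e_k.  All squares are admitted although they lie in a single coset, as this
    avoids choosing an index. *)
Definition coset_rep (t : G) : Prop := t = 1 \/
  exists j s, j < k /\ (t = w k j s \/ t = w k j s * w k j s).

Definition affine_cosets (g : G) : Prop := exists p c, [/\ P p, coset_rep c & g = p * c].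

Lemma affine_cosets_mull p g : P p -> affine_cosets g -> affine_cosets (p * g).
Proof.
move=> Pp [q [t [Pq Tt ->]]]; exists (p * q), t; split=> //; last by rewrite mulgA.
exact: words_mul.
Qed.

Lemma affine_cosets_rep (t : G) : coset_rep t -> affine_cosets t.
Proof. by move=> Tt; exists 1, t; split=> //; [exact: words1 | rewrite mul1g]. Qed.

Lemma affine_cosets_affine p : P p -> affine_cosets p.
Proof.
by move=> Pp; rewrite -[p]mulg1; apply: affine_cosets_mull => //;
  apply: affine_cosets_rep; left.
Qed.

Lemma affine_cosets_wk j s : j < k -> affine_cosets (w k j s).
Proof. by move=> jk; apply: affine_cosets_rep; right; exists j, s; split=> //; left. Qed.

(** The cosets of the representatives are permuted by the w_ij.  By [wsgn_sym] one
    may assume j < k.  If i = k the product of the representative with w_kj is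
    rewritten by the conjugation rules, or by [wsgn_sq_mul] for a square; if i < k
    then w_ij is moved to the left, conjugating the representative. *)
Lemma affine_cosets_mulw g i j s : i <= k -> j <= k -> i != j ->
  affine_cosets g -> affine_cosets (g * w i j s).
Proof.
have ltk a : a <= k -> a != k -> a < k by move=> ak ne; rewrite ltn_neqAle ne.
have ltn a : a < k -> k != a.
  by move=> ak; apply: contraTneq ak => ->; rewrite ltnn.
move=> ik jk ij [p [t [Pp Tt ->]]]; rewrite -mulgA; apply: affine_cosets_mull => // {p Pp}.
wlog jnk : i j s ik jk ij / j != k => [WL|].
  have [jE|] := eqVneq j k; last exact: WL.
  by rewrite wsgn_sym //; apply: WL => //; [neq_sym | rewrite -jE].
have {}jk := ltk _ jk jnk; have kj : k != j by neq_sym.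
have [iE|ink] := eqVneq i k.
  rewrite {i ik}iE in ij *.
  case: Tt => [->|[a [r [ak]]]]; first by rewrite mul1g; apply: affine_cosets_wk.
  have ka := ltn _ ak.
  have [aj|aj] := eqVneq a j.
    subst a; case=> ->.
      have [->|rs] := eqVneq r s.
        by apply: affine_cosets_rep; right; exists j, s; split=> //; right.
      have -> : s = ~~ r by case: (s) (r) rs => [] [].
      by rewrite -wsgnV mulgV; apply: affine_cosets_affine; apply: words1.
    rewrite (wsgn_sq r (~~ s) ka) -wsgnV mulgVK wsgnV.
    exact: affine_cosets_wk.
  have ja : j != a by neq_sym.
  case=> ->.
    rewrite conjgCV wsgnV wsgnJ_source //.
    by apply: affine_cosets_mull; [apply: affine_w | apply: affine_cosets_wk].
  rewrite (wsgn_sq_mul r false (~~ s) ka kj aj) -(wsgnV _ k j s) -mulgA mulgVK wsgnV.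
  by apply: affine_cosets_mull; [apply: words_mul; apply: affine_w | apply: affine_cosets_wk].
have {}ik := ltk _ ik ink; have ki : k != i by neq_sym.
case: Tt => [->|[a [r [ak]]]]; first by rewrite mul1g; apply/affine_cosets_affine/affine_w.
have ka := ltn _ ak.
have [b [q [bk E]]] : exists b q, b < k /\ w k a r ^ w i j s = w k b q.
  have [->|ai] := eqVneq a i.
    by exists j, (r (+) s); split=> //; apply: wsgnJ_target; neq_sym.
  have [->|aj] := eqVneq a j.
    exists i, (r (+) ~~ s); split=> //; rewrite (wsgn_sym s ij).
    by apply: wsgnJ_target; neq_sym.
  by exists a, r; split=> //; apply: wsgnJ_fix; neq_sym.
case=> ->; last rewrite (conjgC (w k a r * w k a r)) (conjMg (w k a r)) E.
  by rewrite conjgC E; apply: affine_cosets_mull; [apply: affine_w | apply: affine_cosets_wk].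
apply: affine_cosets_mull; first exact: affine_w.
by apply: affine_cosets_rep; right; exists b, q; split=> //; right.
Qed.

Lemma coset_rep_mulx (t : G) i j s : coset_rep t -> i <= k -> j <= k -> i != j ->
  exists i' j' s', [/\ i' <= k, j' <= k, i' != j' & t * X i j s = X i' j' s' * t].
Proof.
move=> Tt ik jk ij.
have step a b q i1 j1 s1 :
    a <= k -> b <= k -> a != b -> i1 <= k -> j1 <= k -> i1 != j1 ->
  exists i' j' s', [/\ i' <= k, j' <= k, i' != j' &
    w a b q * X i1 j1 s1 = X i' j' s' * w a b q].
  move=> ak bk ab ik1 jk1 ij1.
  have [i' [j' [s' [ij' E mP]]]] := xsgnJw (~~ q) s1 ab ij1.
  have [ik' jk'] := mP k.+1 ak bk ik1 jk1.
  exists i', j', s'; split=> //.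
  by rewrite -E -wsgnV conjgE invgK -!mulgA mulVg mulg1.
case: Tt => [->|[a [r [ak]]]]; first by exists i, j, s; rewrite mul1g mulg1.
have ka : k != a by apply: contraTneq ak => ->; rewrite ltnn.
have [i' [j' [s' [ik' jk' ij' E]]]] := step _ _ r i j s (leqnn k) (ltnW ak) ka ik jk ij.
case=> ->; first by exists i', j', s'.
have [i2 [j2 [s2 [ik2 jk2 ij2 E2]]]] := step _ _ r i' j' s' (leqnn k) (ltnW ak) ka ik' jk' ij'.
exists i2, j2, s2; split=> //.
by rewrite -(mulgA (w k a r)) E (mulgA (w k a r)) E2 -(mulgA (X i2 j2 s2)).
Qed.

Lemma row_norm_rep g (t : G) : coset_rep t -> N (g * t) = N g.
Proof.
case=> [->|[a [r [ak]]]]; first by rewrite mulg1.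
have ka : k != a by apply: contraTneq ak => ->; rewrite ltnn.
by case=> ->; rewrite ?(mulgA g (w k a r)) !(row_norm_mulw f_x).
Qed.

(** Move the representative to the right of the step.  The new step starts from the
    row e_k and keeps the norm equal to 1, so it cannot have source k. *)
Lemma affine_cosets_mulx g i j s : i <= k -> j <= k -> i != j -> affine_cosets g ->
  N (g * X i j s) = 1%N -> affine_cosets (g * X i j s).
Proof.
move=> ik jk ij [p [t [Pp Tt ->]]]; rewrite -mulgA.
have [i' [j' [s' [ik' jk' ij' ->]]]] := coset_rep_mulx s Tt ik jk ij.
rewrite mulgA row_norm_rep // => N1p; exists (p * X i' j' s'), t; split=> //.
apply: wordsM => //; exists i', j', s'; split=> //.
apply/negP => /eqP ik0; rewrite ik0 in ij' N1p.
have [E _ _] := row_mulx f_x k p s' ij'.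
move: E; rewrite N1p !affine_row // !row_entry1 eqxx (negPf ij').
have -> : N p = 1%N.
  by rewrite -(row_norm1 f k) /row_norm; apply: eq_bigr => l _; rewrite affine_row.
by case: (s').
Qed.

Lemma ascending_affine g : ascending k.+1 g -> N g = 1%N -> affine_cosets g.
Proof.
elim=> {g}[|g i j s ik jk ij Mg IH|g i j s ik jk ij Mg IH le_g].
- by move=> _; apply/affine_cosets_affine/words1.
- by rewrite (row_norm_mulw f_x) // => /IH; apply: affine_cosets_mulw.
move=> Ng; apply: affine_cosets_mulx => //; apply: IH; apply/eqP.
by rewrite eqn_leq (row_norm_gt0 f) andbT -Ng.
Qed.

Lemma stabilizer g : words (corner_gens k.+1) g -> (forall l, v g l = v 1 l) -> P g.
Proof.
move=> /words_ascending Mg vg.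
have /(ascending_affine Mg)[p [t [Pp Tt E]]] : N g = 1%N.
  by rewrite -(row_norm1 f k) /row_norm; apply: eq_bigr => l _; rewrite vg.
have vt l : v t l = v 1 l by rewrite -vg E row_entry_fixl //; apply: affine_row.
have vtk := vt k; rewrite row_entry1 eqxx in vtk.
case: Tt => [t1|[a [r [ak tE]]]]; first by rewrite E t1 mulg1.
have ka : k != a by apply: contraTneq ak => ->; rewrite ltnn.
have [] := row_entry_mulw f_x k 1 r ka; rewrite mul1g !row_entry1 eqxx (negPf ka) => wk wa.
have [] := row_entry_mulw f_x k (w k a r) r ka; rewrite wk wa => wwk _.
by case: tE => tE; move: vtk; rewrite tE ?wk ?wwk; case: (r).
Qed.

End Norm.

(** * Faithfulness on the subgroups of a flag *)

Section Unipotent.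
Variable k : 'I_n.

(** The letters x_ik with i < k; the further bound [r] serves to remove these
    indices one at a time. *)
Definition column_gens (r : nat) (y : G) : Prop :=
  exists i s, [/\ i < r, i < k & y = X i k s].

Lemma words_columnJ i j s u : i < k -> j < k -> i != j ->
  words (column_gens k) u -> words (column_gens k) (u ^ X i j s).
Proof.
have ne (a : 'I_n) : a < k -> a != k by move=> ak; apply: contraTneq ak => ->; rewrite ltnn.
move=> ik jk ij; elim=> [|h y _ IH [a [t [_ ak ->]]]]; first by rewrite conj1g; apply: words1.
rewrite conjMg; apply: words_mul => //.
have U b q : b < k -> words (column_gens k) (X b k q).
  by move=> bk; apply: words_gen; exists b, q.
have [->|aj] := eqVneq a j; first by rewrite xsgnJ_source ?ne //; apply: words_mul; apply: U.
by rewrite xsgnJ_comm ?ne //; [apply: U | rewrite eq_sym ne].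
Qed.

(** The x_ik generate a subgroup normalised by the x_ij with i, j < k. *)
Lemma affine_split p : words (affine_gens k) p ->
  exists h u, [/\ words (corner_gens k) h, words (column_gens k) u & p = h * u].
Proof.
elim=> [|g y _ [h [u [Hh Uu ->]]] [i [j [s [ik jk ij ink ->]]]]].
  by exists 1, 1; rewrite mulg1; split=> //; apply: words1.
have {}ik : i < k by rewrite ltn_neqAle ink.
have [jE|jnk] := eqVneq j k.
  exists h, (u * X i k s); rewrite jE mulgA; split=> //.
  by apply: wordsM => //; exists i, s.
have {}jk : j < k by rewrite ltn_neqAle jnk.
exists (h * X i j s), (u ^ X i j s); split.
- by apply: wordsM => //; exists i, j, s.
- exact: words_columnJ.
by rewrite -!mulgA -conjgC.
Qed.

(** The x_ik commute, so the powers of x_rk can be collected at the end.  The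
    exponent is kept as a pair of natural numbers. *)
Lemma column_split r u : words (column_gens r.+1) u -> forall i, i = r :> nat -> i < k ->
  exists u' c d, words (column_gens r) u' /\ u = u' * X i k false ^+ c * X i k true ^+ d.
Proof.
move=> Uu i ir ik; have ink : i != k by apply: contraTneq ik => ->; rewrite ltnn.
elim: Uu => [|g y _ [u' [c [d [Uu' ->]]]] [j [s [jr jk ->]]]].
  by exists 1, 0%N, 0%N; rewrite !mulg1; split=> //; apply: words1.
have jnk : j != k by apply: contraTneq jk => ->; rewrite ltnn.
have C : X i k false ^+ c * X i k true ^+ d * X j k s
       = X j k s * (X i k false ^+ c * X i k true ^+ d).
  by apply/commute_sym/commuteM; apply: commuteX; apply: xsgn_comm; rewrite // eq_sym.
have [ji|ji] := eqVneq j i.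
  case: s C => C; subst j.
    by exists u', c, d.+1; rewrite expgSr !mulgA.
  exists u', c.+1, d; split=> //.
  by rewrite -(mulgA u') -(mulgA u') C expgS !mulgA.
exists (u' * X j k s), c, d; split; last by rewrite -(mulgA u') -(mulgA u') C !mulgA.
apply: wordsM => //; exists j, s; split=> //.
by rewrite ltn_neqAle -{1}ir (inj_eq val_inj) ji -ltnS.
Qed.

End Unipotent.

Section Faithful.
Variable f : UMagmaMorphism.type G (SL n int).
Hypothesis f_x : forall i j, i != j -> SLval (f (x i j)) = (1%:M + delta_mx i j)%R.

Lemma row_entry_mulx_pow i g j l s (c : nat) : j != l -> row_entry f i g j = 1%R ->
  row_entry f i (g * X j l s ^+ c) l = (row_entry f i g l + signed s c%:Z)%R /\
  (forall l', l' != l -> row_entry f i (g * X j l s ^+ c) l' = row_entry f i g l').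
Proof.
move=> jl gj1; elim: c => [|c [IH1 IH2]].
  by rewrite mulg1; case: s; rewrite /= ?oppr0 addr0.
rewrite expgSr mulgA; have [_ E O] := row_mulx f_x i (g * X j l s ^+ c) s jl.
split=> [|l' l'l]; last by rewrite O // IH2.
by rewrite E IH1 IH2 // gj1; case: (s) => /=; lia.
Qed.

Lemma column_row k r u i : words (column_gens k r) u -> r <= k ->
  (forall l, l != k -> row_entry f i u l = (i == l)%:R%R) /\
  (r <= i -> row_entry f i u k = (i == k)%:R%R).
Proof.
move=> Uu rk; elim: Uu => [|g y _ [IH1 IH2] [j [s [jr jk ->]]]].
  by split=> *; rewrite row_entry1.
have jnk : j != k by apply: contraTneq jk => ->; rewrite ltnn.
have [_ E O] := row_mulx f_x i g s jnk.
split=> [l lk|ri]; first by rewrite O // IH1.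
rewrite E IH2 // IH1 // (_ : (i == j) = false); last first.
  by apply: contraTF jr => /eqP <-; rewrite -leqNgt.
by case: (s); rewrite /= ?oppr0 addr0.
Qed.

(** The exponent of x_rk can be read off from the entry (r, k) of the matrix. *)
Lemma column_faithful k r u : r <= k -> words (column_gens k r) u ->
  (forall i, row_entry f i u k = (i == k)%:R%R) -> u = 1.
Proof.
elim: r u => [|r IH] u rk Uu col.
  by elim: Uu {col} => // h y _ _ [i [s []]].
pose i : 'I_n := Ordinal (leq_trans rk (ltnW (ltn_ord k))).
have ik : i != k by rewrite -(inj_eq val_inj) /= ltn_eqF.
have [u' [c [d [Uu' E]]]] := column_split Uu (erefl : i = r :> nat) rk.
have [row1 row2] := column_row i Uu' (ltnW rk).
have u'i : row_entry f i u' i = 1%R by rewrite row1 // eqxx.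
have [E1 O1] := row_entry_mulx_pow false c ik u'i.
have [] := row_entry_mulx_pow (i := i) (g := u' * X i k false ^+ c) true d ik.
  by rewrite O1.
rewrite -E E1 col row2 // (negPf ik) => Ecd _.
have cd : c = d by move: Ecd => /=; lia.
have E0 : u = u'.
  have C : commute (X i k false) (X i k true) by apply: xsgn_comm; rewrite // eq_sym.
  by rewrite E cd -mulgA -expgMn // xsgnK expg1n mulg1.
rewrite E0; apply: IH => //; first exact: ltnW.
by move=> j; rewrite -E0.
Qed.

Lemma corner_column k (h : G) : words (corner_gens k) h ->
  forall i, row_entry f i h k = (i == k)%:R%R.
Proof.
elim=> [|g y _ IH [a [b [s [ak bk ab ->]]]]] i; first by rewrite row_entry1.
rewrite (row_entry_mulx_off f_x) //; apply: contraTneq bk => <-; by rewrite ltnn.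
Qed.

(** Induction on the number of indices in use.  The row of f(g) with the last index k
    being that of the identity, g lies in the affine subgroup, hence g = h u with h
    in the smaller corner.  Column k of f(u) = f(h)^-1 is that of the identity, so
    u = 1. *)
Lemma faithful (m : nat) g : m <= n -> words (corner_gens m) g -> f g = 1 -> g = 1.
Proof.
elim: m g => [|m IH] g mn Hg fg.
  by elim: Hg => // h y _ _ [i [j [s []]]].
pose k := Ordinal mn.
have /affine_split[h [u [Hh Uu E]]] : words (affine_gens k) g.
  by apply: (stabilizer f_x) => // l; rewrite /row_entry fg gmulf1.
have u1 : u = 1.
  apply: (column_faithful (leqnn k) Uu) => i.
  have -> : row_entry f i u k = row_entry f i h^-1 k.
    rewrite /row_entry; congr (SLval _ _ _); apply: (mulgI (f h)).
    by rewrite -!gmulfM -E fg mulgV gmulf1.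
  apply: corner_column; apply: words_inv Hh => y [a [b [s [ak bk ab ->]]]].
  by exists a, b, (~~ s); rewrite xsgnV.
by apply: IH => //; rewrite ?E ?u1 ?mulg1 // ltnW.
Qed.

End Faithful.

End OrderFour.
End SteinbergCalculus.

(** * Elementary matrices generate the special linear group *)

Section Elementary.
Local Open Scope group_scope.
Variable n : nat.
Implicit Types (i j k l a b : 'I_n) (s t : bool) (g : SL n int).

(** The value on the diagonal is a dummy, chosen so that the determinant is always
    one and [elem] is a total function. *)
Definition elem_mx i j : 'M[int]_n := (1%:M + (if i == j then 0 else delta_mx i j))%R.

Lemma elem_mxE i j : i != j -> elem_mx i j = (1%:M + delta_mx i j)%R.
Proof. by rewrite /elem_mx => /negPf->. Qed.

Lemma det_elem_mx i j : (\det (elem_mx i j) == 1)%R.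
Proof.
rewrite /elem_mx; case: (eqVneq i j) => [_|ij]; first by rewrite addr0 det1.
wlog lt_ji : i j ij / (j < i)%N => [WL|].
  have [/WL|] := ltnP j i; first exact.
  rewrite leq_eqVlt (inj_eq val_inj) (negPf ij) /= => lt_ij.
  rewrite -det_tr raddfD /= trmx1 trmx_delta; apply: WL => //; neq_sym.
rewrite det_trig; last first.
  apply/is_trig_mxP => a b lt_ab; rewrite !mxE.
  rewrite (_ : (a == b) = false); last by apply: contraTF lt_ab => /eqP->; rewrite ltnn.
  case: (eqVneq a i) => [ai|//]; case: (eqVneq b j) => [bj|//].
  by subst a b; rewrite ltnNge ltnW in lt_ab.
rewrite big1 // => a _; rewrite !mxE eqxx; case: (eqVneq a i) => //= ->.
by rewrite (negPf ij) addr0.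
Qed.

Definition elem i j : SL n int := MkSL (det_elem_mx i j).

Lemma elemE i j : i != j -> SLval (elem i j) = (1%:M + delta_mx i j)%R.
Proof. exact: elem_mxE. Qed.

Lemma elem_comm i j k l : i != j -> k != l -> i != l -> j != k ->
  commute (elem i j) (elem k l).
Proof.
move=> ij kl il jk; apply: val_inj; rewrite /= !elem_mxE // !mulmxDl !mulmxDr !mul1mx !mulmx1.
rewrite mul_delta_mx_0 // mul_delta_mx_0 1?eq_sym //.
by rewrite !addr0 -!addrA; congr (_ + _)%R; rewrite addrC.
Qed.

Lemma elem_commg i j k : i != j -> j != k -> i != k ->
  [~ elem i j, elem j k] = elem i k.
Proof.
move=> ij jk ik.
have E : elem i j * elem j k = elem j k * (elem i j * elem i k).
  have E1 : ((1%:M + delta_mx i j) *m (1%:M + delta_mx i k)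
      = 1%:M + delta_mx i j + delta_mx i k :> 'M[int]_n)%R.
    by rewrite mulmxDr mulmx1 mulmxDl mul1mx mul_delta_mx_0 ?addr0 // eq_sym.
  apply: val_inj; rewrite /= !elem_mxE // E1 mulmxDr mulmx1 !mulmxDl !mulmxDr !mul1mx mulmx1.
  rewrite mul_delta_mx !mul_delta_mx_0 1?eq_sym // !addr0 -!addrA; congr (_ + _)%R.
  by congr (_ + _)%R; rewrite addrC.
by rewrite commgEl /conjg E mulKg mulKg.
Qed.

Local Notation X := (xsgn elem).
Local Notation w := (wsgn elem).
Let f : UMagmaMorphism.type (SL n int) (SL n int) := idfun.
Local Notation E := (words (corner_gens elem n)).
Local Notation v := (row_entry f).
Local Notation N := (row_norm f).

Let f_elem i j : i != j -> SLval (f (elem i j)) = (1%:M + delta_mx i j)%R.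
Proof. exact: elemE. Qed.

Lemma elementary_x i j s : i != j -> E (X i j s).
Proof. by move=> ij; apply: words_gen; exists i, j, s; split. Qed.

Lemma elementary_w i j s : i != j -> E (w i j s).
Proof.
move=> ij; apply: words_mul; [apply: words_mul|]; apply: elementary_x => //.
by rewrite eq_sym.
Qed.

Lemma elementaryV g : E g -> E g^-1.
Proof.
by apply: words_inv => y [i [j [s [im jm ij ->]]]]; exists i, j, (~~ s); rewrite xsgnV.
Qed.

Lemma elementary_cancel g h : E h -> E (g * h) -> E g.
Proof. by move=> Eh Egh; rewrite -[g](mulgK h); apply: words_mul => //; apply: elementaryV. Qed.

Definition identity_from (m : nat) g := forall i, m <= i -> forall l, v i g l = (i == l)%:R%R.

Lemma identity_from_mulx m g i j s : i < m -> i != j ->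
  identity_from m g -> identity_from m (g * X i j s).
Proof.
move=> im ij tg a ma l; rewrite (row_entry_mulx f_elem) // !tg // (_ : (a == i) = false).
  by case: s; rewrite /= mul0rn ?oppr0 addr0.
by apply: contraTF im => /eqP <-; rewrite -leqNgt.
Qed.

Lemma identity_from_mulw m g i j s : i < m -> j < m -> i != j ->
  identity_from m g -> identity_from m (g * w i j s).
Proof.
move=> im jm ij tg; rewrite /wsgn !mulgA.
apply: identity_from_mulx => //; apply: identity_from_mulx; rewrite 1?eq_sym //.
exact: identity_from_mulx.
Qed.

(** Once row [k] is that of the identity up to its diagonal entry, adding multiples of
    the k-th column clears the rest of it. *)
Lemma elementary_clear k g : identity_from k.+1 g ->
  (forall l, l <= k -> v k g l = (k == l)%:R%R) ->
  (forall h, identity_from k h -> E h) -> E g.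
Proof.
move=> + + IH; move: {2}(N k g).+1 (ltnSn (N k g)) => L.
elim: L g => // L IHL g gL tg low.
have vk : v k g k = 1%R by rewrite low // eqxx.
case: (pickP (fun l => (k < l) && (v k g l != 0%R))) => [l /andP[kl vl]|noX]; last first.
  apply: IH => i; rewrite leq_eqVlt => /orP[/eqP/val_inj <-|]; last exact: tg.
  move=> l; have [/low//|kl] := leqP l k.
  have := noX l; rewrite kl /= => /negbFE/eqP->.
  by rewrite -(inj_eq val_inj) (ltn_eqF kl).
have nkl : k != l by rewrite -(inj_eq val_inj) (ltn_eqF kl).
pose s := (0 < v k g l)%R.
apply: (elementary_cancel (elementary_x s nkl)); apply: IHL.
- have [Ns _ _] := row_mulx f_elem k g s nkl.
  move: Ns vl gL; rewrite vk /s.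
  by case: (boolP (0 < _)%R) => /=; move: (N k g) (N k _) (v k g l) => ? ? ?; lia.
- exact: identity_from_mulx.
move=> a ak; rewrite (row_entry_mulx_off f_elem) //; first exact: low.
by rewrite -(inj_eq val_inj) (ltn_eqF (leq_ltn_trans ak kl)).
Qed.

(** Such a matrix is triangular, with determinant its first diagonal entry. *)
Lemma first_row_diag k g : k = 0 :> nat -> identity_from 1 g -> v k g k = 1%R.
Proof.
move=> k0 tg; have := det_SL g; rewrite -det_tr det_trig; last first.
  apply/is_trig_mxP => a b lt_ab; rewrite mxE.
  rewrite -[SLval g b a]/(v b g a) tg ?(leq_ltn_trans _ lt_ab) //.
  by rewrite -(inj_eq val_inj) gtn_eqF.
rewrite (bigD1 k) //= big1 ?mulr1 ?mxE // => a ak; rewrite mxE.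
rewrite -[SLval g a a]/(v a g a) tg ?eqxx // lt0n.
by apply: contraNneq ak => a0; rewrite -(inj_eq val_inj) /= a0 k0.
Qed.

(** The product of row [k] of g with column [k] of its inverse; the rows of the
    inverse below [k] are those of the identity as well. *)
Lemma row_unimodular k g : identity_from k.+1 g ->
  (\sum_(l < n | (l <= k)%N) v k g l * SLval g^-1%g l k = 1)%R.
Proof.
move=> tg; have := row_entry1 f k k.
rewrite eqxx mulr1n -(mulgV g) /row_entry -[f _]/(g * g^-1)%g SLM mxE => <-.
rewrite [RHS](bigID (fun l : 'I_n => l <= k)) /= [X in (_ + X)%R]big1 ?addr0 // => l.
rewrite -ltnNge => kl; rewrite -[SLval g^-1%g l k]/(v l g^-1%g k).
rewrite -(@row_entry_fixl _ _ f l g); last by move=> l'; rewrite tg // row_entry1.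
by rewrite mulgV row_entry1 -(inj_eq val_inj) (gtn_eqF kl) mulr0.
Qed.

(** Euclid's algorithm on the first k + 1 entries of row [k], driven by the norm.  When
    it stops a single entry is left, which is a unit by [row_unimodular].  Some w_kj
    moves it to the diagonal with the right sign; a wrong sign on the diagonal itself
    is first moved away, which is possible unless k = 0, and there it is excluded by
    the determinant. *)
Lemma elementary_euclid k g : identity_from k.+1 g ->
  (forall h, identity_from k h -> E h) -> E g.
Proof.
move=> + IH; move: {2}(N k g).+1 (ltnSn (N k g)) => L.
elim: L g => // L IHL g gL tg.
case: (pickP (fun ij : 'I_n * 'I_n => [&& ij.1 <= k, ij.2 <= k, ij.1 != ij.2,
   v k g ij.1 != 0%R & `|v k g ij.1| <= `|v k g ij.2|])) => [[i j]|no] /=.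
  case/and5P => ik jk ij vi le_ij.
  pose s := (0 < v k g i)%R (+) ~~ (0 < v k g j)%R.
  apply: (elementary_cancel (elementary_x s ij)); apply: IHL; last exact: identity_from_mulx.
  have [Ns _ _] := row_mulx f_elem k g s ij.
  by move: Ns vi le_ij gL; rewrite /s;
    case: (boolP (0 < v k g i)%R); case: (boolP (0 < v k g j)%R) => /=;
    move: (N k g) (N k _) (v k g i) (v k g j) => ? ? ? ?; lia.
have [j [jk vj other]] : exists j, [/\ j <= k, `|v k g j|%N = 1%N &
    forall l, l <= k -> l != j -> v k g l = 0%R].
  have row := row_unimodular tg.
  have [j /andP[jk vj]|allz] := pickP (fun l : 'I_n => (l <= k) && (v k g l != 0%R)); last first.
    rewrite big1 // in row => l lk; have := allz l; rewrite lk /= => /negbFE/eqP->.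
    by rewrite mul0r.
  have other l : l <= k -> l != j -> v k g l = 0%R.
    move=> lk lj; apply/eqP; apply: contraFT (no (j, l)) => vl; rewrite /= jk lk vj eq_sym lj /=.
    by rewrite leqNgt; apply: contraFN (no (l, j)) => /ltnW le; rewrite /= lk jk lj vl le.
  exists j; split=> //.
  move: row; rewrite (bigD1 j) //= big1 ?addr0; last first.
    by move=> l /andP[lk lj]; rewrite other ?mul0r.
  by move/(congr1 absz); rewrite abszM => /eqP; rewrite muln_eq1 => /andP[/eqP].
have diag h : identity_from k.+1 h -> v k h k = 1%R ->
    (forall l, l <= k -> l != k -> v k h l = 0%R) -> E h.
  move=> th hk h0; apply: (elementary_clear th) => // l lk.
  by have [<-|kl] := eqVneq k l; [exact: hk | apply: h0; rewrite // eq_sym].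
have off h i : identity_from k.+1 h -> i <= k -> k != i -> `|v k h i|%N = 1%N ->
    (forall l, l <= k -> l != i -> v k h l = 0%R) -> E h.
  move=> th ik ki vi h0.
  pose s := (0 < v k h i)%R.
  apply: (elementary_cancel (elementary_w s ki)); have [wk wi] := row_entry_mulw f_elem k h s ki.
  apply: diag; first exact: identity_from_mulw.
    by rewrite wk; move: vi; rewrite /s; case: (boolP (0 < _)%R) => /=;
      move: (v k h i) => ?; lia.
  move=> l lk nlk; have [->|li] := eqVneq l i.
    by rewrite wi h0 //; case: (s); rewrite //= oppr0.
  by rewrite (row_entry_mulw_off f_elem) ?h0.
have [kj|kj] := eqVneq k j; last exact: off kj vj other.
subst j.
have [k0|k_gt0] := posnP k.
  by apply: diag => //; apply: first_row_diag => //; rewrite -k0.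
pose o : 'I_n := Ordinal (leq_ltn_trans (leq0n k) (ltn_ord k)).
have ko : k != o by rewrite -(inj_eq val_inj) -lt0n.
have [wk wo] := row_entry_mulw f_elem k g true ko.
apply: (elementary_cancel (elementary_w true ko)); apply: (off _ o) => //.
- exact: identity_from_mulw.
- by rewrite wo /= abszN.
move=> l lk lo; have [->|nlk] := eqVneq l k; first by rewrite wk /= other // eq_sym.
by rewrite (row_entry_mulw_off f_elem) ?other.
Qed.

Lemma elem_generate g : E g.
Proof.
suff H m h : m <= n -> identity_from m h -> E h.
  by apply: (H n) => // i; rewrite leqNgt ltn_ord.
elim: m h => [|m IH] h mn th.
  suff -> : h = 1 by apply: words1.
  by apply: val_inj; apply/matrixP => i j; rewrite mxE -[LHS]/(v i h j) th.
by apply: (@elementary_euclid (Ordinal mn)) => // h'; apply: IH; apply: ltnW.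
Qed.

End Elementary.

(** * The words tau in a group with Steinberg relations *)

Section TauGeneric.
Local Open Scope group_scope.
Variables (n : nat) (n_gt0 : 0 < n) (G : groupType) (x : 'I_n -> 'I_n -> G).
Hypothesis x_commg : forall i j k, i != j -> j != k -> i != k ->
  [~ x i j, x j k] = x i k.

Let first : 'I_n := Ordinal n_gt0.
Let last : 'I_n := rev_ord first.

Variables a b : G.
(* What is used of a: conjugation by it shifts the indices of x_{i+1,i}
   cyclically, with the sign (-1)^(n-1) at the wrap-around. *)
Hypothesis b_x : forall i : 'I_n, val i = 1%N -> b = x i first.
Hypothesis a_shift : forall i j i' j' : 'I_n, i = j.+1 :> nat -> i' = i.+1 :> nat ->
  j' = j.+1 :> nat -> x i j ^ a = x i' j'.
Hypothesis a_wrap : forall i j : 'I_n, i = j.+1 :> nat -> i.+1 = n ->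
  x i j ^ a = if odd n then x first last else (x first last)^-1.

Lemma b_conj (i j : 'I_n) : i = j.+1 :> nat -> a ^- j * b * a ^+ j = x i j.
Proof.
case: j => j /=; elim: j i => [|j IH] i lt_j /= ij.
  by rewrite invg1 mul1g mulg1 (b_x ij); congr (x _ _); apply: val_inj.
have lt_j' := ltnW lt_j.
rewrite -(@a_shift (Ordinal lt_j) (Ordinal lt_j') i (Ordinal lt_j)) //.
by rewrite -(IH _ lt_j') // expgSr invgM /conjg !mulgA.
Qed.

Lemma tau_1nE : 1 < n -> tau_1n n a b = x first last.
Proof.
move=> n_gt1; rewrite /tau_1n.
have -> : a ^- n.-1 * b * a ^+ n.-1 = if odd n then x first last else (x first last)^-1.
  have lt1 : n.-1 < n by rewrite prednK.
  have lt2 : n.-2 < n by apply: leq_ltn_trans lt1; apply: leq_pred.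
  have E1 : n.-1 = n.-2.+1 by rewrite prednK // -subn1 subn_gt0.
  rewrite -(@a_wrap (Ordinal lt1) (Ordinal lt2)) //= ?prednK //.
  by rewrite -b_conj // {1 2}E1 expgSr invgM /conjg !mulgA.
by case: (odd n); rewrite ?invgK.
Qed.

Lemma tau_lowerE d (i j : 'I_n) : i = (j + d.+1)%N :> nat ->
  tau_lower a b d.+1 j.+1 = x i j.
Proof.
elim: d i j => [|d IH] i j ij; first by apply: b_conj; rewrite ij addn1.
have lt_j : j.+1 < n by apply: leq_ltn_trans (ltn_ord i); rewrite ij addnS ltnS leq_addr.
rewrite -[LHS]/([~ tau_lower a b d.+1 j.+2, a ^- j * b * a ^+ j]).
rewrite (IH i (Ordinal lt_j)) /= ?ij ?addnS // (@b_conj (Ordinal lt_j)) //.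
by apply: x_commg; rewrite -(inj_eq val_inj) /= ?ij; lia.
Qed.

Lemma tau_lastE (i : 'I_n) : i != last -> tau_last n a b i.+1 = x i last.
Proof.
rewrite -(inj_eq val_inj) /= subn1 => iln; have n_gt1 : 1 < n by have := ltn_ord i; lia.
rewrite /tau_last eqSS; case: eqP => [i0|i0].
  by rewrite tau_1nE //; congr (x _ _); apply: val_inj.
case E : (val i) i0 iln => [|d] // _ iln.
rewrite tau_1nE // (@tau_lowerE d i first) /= ?E //.
by apply: x_commg; rewrite -(inj_eq val_inj) /= ?E; lia.
Qed.

Lemma tauE (i j : 'I_n) : i != j -> tau n a b i.+1 j.+1 = x i j.
Proof.
move=> ij; rewrite /tau ltnS; have [lt_ji|le_ij] := ltnP j i.
  rewrite subSS -(subnSK lt_ji) (@tau_lowerE _ i) //.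
  by rewrite subnSK // subnKC // ltnW.
move: (ij); rewrite -(inj_eq val_inj) /= => nij.
have li : i != last by rewrite -(inj_eq val_inj) /=; have := ltn_ord j; lia.
rewrite tau_lastE //.
case: eqP => [jn|jn].
  by congr (x _ _); apply: val_inj => /=; lia.
have -> : n - j.+1 = (n - j.+2).+1 by have := ltn_ord j; lia.
rewrite (@tau_lowerE _ last j) /=; last by have := ltn_ord j; lia.
by apply: x_commg; rewrite // -(inj_eq val_inj) /=; have := ltn_ord j; lia.
Qed.

End TauGeneric.

(** * The product of the Weyl elements *)

Section WeylProduct.
Local Open Scope group_scope.
Variables (n : nat) (n_gt0 : 0 < n) (G : groupType).
Let first : 'I_n := Ordinal n_gt0.

(** The last relation in terms of the x_ij; the default value [first] of [insubd] is
    never reached for m < n. *)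
Definition weyl_prod (x : 'I_n -> 'I_n -> G) (m : nat) : G :=
  \big[*%g/1]_(i <- rev (iota 1 m)) wsgn x (insubd first i.-1) (insubd first i) false.

Lemma weyl_prodS x m : weyl_prod x m.+1 =
  wsgn x (insubd first m) (insubd first m.+1) false * weyl_prod x m.
Proof. by rewrite /weyl_prod -[in LHS](addn1 m) iotaD rev_cat big_cat big_seq1 add1n. Qed.

Lemma weylE x a b : (forall i j : 'I_n, i != j -> tau n a b i.+1 j.+1 = x i j) ->
  \big[*%g/1]_(i <- rev (iota 1 n.-1)) weyl n a b i = weyl_prod x n.-1.
Proof.
move=> tx; apply: eq_big_seq => i; rewrite mem_rev mem_iota => /andP[i_gt0 lt_in].
have lti : i < n by lia. have lti' : i.-1 < n by lia.
have vi : val (insubd first i) = i by rewrite val_insubd lti.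
have vi' : val (insubd first i.-1) = i.-1 by rewrite val_insubd lti'.
rewrite /weyl /wsgn /xsgn -!tx -?(inj_eq val_inj) vi vi' ?prednK //; lia.
Qed.

End WeylProduct.

Section CompanionMatrix.
Variables (n : nat) (n_gt1 : 1 < n).
Let n_gt0 : 0 < n := ltnW n_gt1.
Let first : 'I_n := Ordinal n_gt0.
Let last : 'I_n := rev_ord first.
Let f : UMagmaMorphism.type (SL n int) (SL n int) := idfun.
Local Open Scope ring_scope.

Lemma mx_aE (p q : 'I_n) : mx_a n p q =
  if p.+1 == n then (-1) ^+ n.-1 * (q == 0 :> nat)%:R else (q == p.+1 :> nat)%:R.
Proof.
rewrite /mx_a !mxE summxE.
rewrite (eq_bigr (fun i => if i == p.+1 then (q == p.+1 :> nat)%:R else 0)); last first.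
  move=> i _; rewrite mxE eqSS [p.+1 == i]eq_sym.
  by case: eqP => [->|]; rewrite //= eqSS.
rewrite -big_mkcond big_nat1_eq /= ltn_neqAle ltn_ord andbT eqSS.
case: eqP => [_|_]; rewrite ?add0r /= ?andbT //.
by rewrite mulr0 addr0.
Qed.

Lemma w_elem_mul (i j : 'I_n) (Q : SL n int) (p q : 'I_n) : i != j ->
  SLval (wsgn (@elem n) i j false * Q)%g p q =
  if p == i then SLval Q j q else if p == j then - SLval Q i q else SLval Q p q.
Proof.
move=> ij; have ji : j != i by rewrite eq_sym.
rewrite SLM mxE.
have W l : SLval (wsgn (@elem n) i j false) p l =
   if l == i then - (p == j)%:R else if l == j then (p == i)%:R else (p == l)%:R.
  rewrite -[wsgn _ i j _]mul1g -[LHS]/(row_entry f p _ l).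
  have [wi wj] := row_entry_mulw (f := f) (@elemE n) p 1%g false ij.
  case: (eqVneq l i) => [->|li]; first by rewrite wi row_entry1.
  case: (eqVneq l j) => [->|lj]; first by rewrite wj row_entry1.
  by rewrite (row_entry_mulw_off (f := f) (@elemE n)) // row_entry1.
rewrite (eq_bigr _ (fun l _ => congr1 (fun z => z * _) (W l))).
rewrite (bigD1 i) //= (bigD1 j) //= !eqxx (negPf ji) addrA.
case: (eqVneq p i) => [->|pi].
  rewrite (negPf ij) oppr0 mul0r add0r mul1r big1 ?addr0 // => l /andP[li lj].
  by rewrite (negPf li) (negPf lj) eq_sym (negPf li) mul0r.
case: (eqVneq p j) => [->|pj].
  rewrite mulN1r mul0r addr0 big1 ?addr0 // => l /andP[li lj].
  by rewrite (negPf li) (negPf lj) eq_sym (negPf lj) mul0r.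
rewrite oppr0 !mul0r !add0r (bigD1 p) /=; last by rewrite pi pj.
rewrite (negPf pi) (negPf pj) eqxx mul1r big1 ?addr0 // => l /andP[/andP[li lj] lp].
by rewrite (negPf li) (negPf lj) eq_sym (negPf lp) mul0r.
Qed.

(** The partial product w_m ... w_1 is the signed cycle sending e_1, ..., e_m to the next
    basis vector and e_(m+1) to (-1)^m e_1. *)
Lemma weyl_prod_elem m (p q : 'I_n) : (m < n)%N ->
  SLval (weyl_prod n_gt0 (@elem n) m) p q =
  if (p < m)%N then (q == p.+1 :> nat)%:R else
  if p == m :> nat then (-1) ^+ m * (q == 0%N :> nat)%:R else (p == q)%:R.
Proof.
elim: m p q => [|m IH] p q mn.
  rewrite /weyl_prod big_nil SL1 mxE ltn0 expr0 mul1r -(inj_eq val_inj) /=.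
  by case: (nat_of_ord p =P 0%N) => // ->; rewrite eq_sym.
have vm : val (insubd first m) = m by rewrite val_insubd ltnW.
have vm1 : val (insubd first m.+1) = m.+1 by rewrite val_insubd mn.
have pm : (p == insubd first m) = (p == m :> nat) by rewrite -(inj_eq val_inj) vm.
have pm1 : (p == insubd first m.+1) = (p == m.+1 :> nat) by rewrite -(inj_eq val_inj) vm1.
have qm1 : (insubd first m.+1 == q) = (q == m.+1 :> nat).
  by rewrite -(inj_eq val_inj) vm1 eq_sym.
rewrite weyl_prodS w_elem_mul; last by rewrite -(inj_eq val_inj) vm vm1 ltn_eqF.
have {}IH p' := IH p' q (ltnW mn).
rewrite pm pm1 !IH vm vm1 qm1 ltnn eqxx ltnNge leqnSn /= (gtn_eqF (ltnSn m)) ltnS.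
case: (ltngtP p m) => [lt_pm|gt_pm|->] //=.
  by rewrite ltn_eqF // ltnW.
by case: eqP => // _; rewrite exprS mulN1r mulNr.
Qed.

Lemma weyl_prod_mx_a : SLval (weyl_prod n_gt0 (@elem n) n.-1) = mx_a n.
Proof.
apply/matrixP => p q; rewrite weyl_prod_elem ?prednK // mx_aE.
have -> : (p.+1 == n) = (p == n.-1 :> nat) by have := n_gt0; lia.
have : (p <= n.-1)%N by rewrite -ltnS prednK.
by rewrite leq_eqVlt; case: eqP => [->|_ /= ->]; rewrite ?ltnn.
Qed.

Lemma mul_delta_mxl (A : 'M[int]_n) (i j p q : 'I_n) :
  (delta_mx i j *m A) p q = (p == i)%:R * A j q.
Proof.
rewrite mxE (bigD1 j) //= big1 ?addr0 => [|l lj]; first by rewrite mxE eqxx andbT.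
by rewrite mxE (negPf lj) andbF mul0r.
Qed.

Lemma mul_delta_mxr (A : 'M[int]_n) (i j p q : 'I_n) :
  (A *m delta_mx i j) p q = A p i * (q == j)%:R.
Proof.
rewrite mxE (bigD1 i) //= big1 ?addr0 => [|l li]; first by rewrite mxE eqxx.
by rewrite mxE (negPf li) mulr0.
Qed.

Lemma elem_shift (A : SL n int) : SLval A = mx_a n ->
  forall i j i' j' : 'I_n, i = j.+1 :> nat -> i' = i.+1 :> nat -> j' = j.+1 :> nat ->
  (@elem n i j ^ A = @elem n i' j')%g.
Proof.
move=> EA i j i' j' ij ii' jj'.
have nij : i != j by rewrite -(inj_eq val_inj) /= ij; lia.
have nij' : i' != j' by rewrite -(inj_eq val_inj) /= ii' jj' ij; lia.
apply: (mulgI A); rewrite -conjgC; apply: val_inj.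
rewrite /= !elem_mxE // mulmxDl mulmxDr mul1mx mulmx1; congr (_ + _).
apply/matrixP => p q; rewrite mul_delta_mxl mul_delta_mxr EA !mx_aE.
have i'n := ltn_ord i'; have i'0 : (i' == 0%N :> nat) = false by lia.
have jn : (j.+1 == n) = false by lia.
rewrite jn i'0 mulr0 -!natrM -(inj_eq val_inj) -[q == j'](inj_eq val_inj) /= ii' jj'.
case: (p.+1 =P n) => [pn|_]; last by rewrite natrM eqSS eq_sym.
have -> : (p == i :> nat) = false by lia.
by rewrite mul0n mul0r.
Qed.

Lemma elem_wrap (A : SL n int) : SLval A = mx_a n ->
  forall i j : 'I_n, i = j.+1 :> nat -> i.+1 = n ->
  (@elem n i j ^ A = if odd n then @elem n first last else (@elem n first last)^-1)%g.
Proof.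
move=> EA i j ij iN.
have nij : i != j by rewrite -(inj_eq val_inj) /= ij; lia.
have fl : first != last by rewrite -(inj_eq val_inj) /=; lia.
have -> : (if odd n then @elem n first last else (@elem n first last)^-1)%g
    = xsgn (@elem n) first last (~~ odd n) by rewrite /xsgn; case: (odd n).
apply: (mulgI A); rewrite -conjgC; apply: val_inj.
rewrite /= (SLval_xsgn (f := f) (@elemE n)) // elem_mxE // mulmxDl mulmxDr mul1mx mulmx1.
congr (_ + _); rewrite -scalemxAr.
apply/matrixP => p q; rewrite [RHS]mxE mul_delta_mxl mul_delta_mxr EA !mx_aE /=.
have -> : (j.+1 == n) = false by have := ltn_ord j; lia.
have -> : (p.+1 == n) = (p == i) by rewrite -(inj_eq val_inj) /=; lia.
have -> : (q == last) = (q == j.+1 :> nat) by rewrite -(inj_eq val_inj) /=; lia.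
case: (p == i); last by rewrite !mul0r mulr0.
have sgn : signed (~~ odd n) 1 = (-1) ^+ n.-1.
  by rewrite -signr_odd -[in LHS](prednK n_gt0) /= negbK; case: (odd _).
by rewrite sgn mulr1 mulrA -exprD addnn -signr_odd odd_double.
Qed.

End CompanionMatrix.

(** * Homomorphisms out of a presented group *)

Section FreeEval.
Local Open Scope group_scope.
Variables (X : choiceType) (H : groupType) (phi : X -> H).

Definition eval_letter (l : letter X) : H := if l.2 then (phi l.1)^-1 else phi l.1.

Definition eval_word (u : seq (letter X)) : H := \big[*%g/1]_(l <- u) eval_letter l.

Definition free_eval (y : free_group X) : H := eval_word y.

Lemma eval_letterV l : eval_letter (inv_letter l) = (eval_letter l)^-1.
Proof. by case: l => z [] /=; rewrite /eval_letter //= invgK. Qed.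

Lemma eval_push l u : eval_word (push l u) = eval_letter l * eval_word u.
Proof.
rewrite /eval_word; case: u => [|l' u] /=; first by rewrite big_seq1 big_nil mulg1.
by case: eqP => [->|_]; rewrite ?big_cons // eval_letterV mulVKg.
Qed.

Lemma eval_reduce u : eval_word (reduce u) = eval_word u.
Proof.
elim: u => //= l u IH; rewrite eval_push -/(reduce u) IH.
by rewrite /eval_word big_cons.
Qed.

Lemma free_evalM : {morph free_eval : y z / y * z}.
Proof. by move=> y z; rewrite /free_eval /= eval_reduce /eval_word big_cat. Qed.

Lemma free_eval_gen z : free_eval (free_gen z) = phi z.
Proof. by rewrite /free_eval eval_reduce /eval_word big_seq1. Qed.

Lemma free_eval1 : free_eval 1 = 1.
Proof. by rewrite /free_eval eval_reduce /eval_word big_nil. Qed.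

HB.instance Definition _ := isUMagmaMorphism.Build _ _ free_eval (free_eval1, free_evalM).
End FreeEval.

Section Quotient.
Local Open Scope group_scope.
Variables (G : groupType) (R : seq G).

Lemma quotient_projF : {morph @quotient_proj G R : y z / y / z}.
Proof.
move=> y z; rewrite -quotient_projM -quotient_projV.
by [].
Qed.

HB.instance Definition _ :=
  isGroupMorphism.Build G (quotient_group R) (@quotient_proj G R) quotient_projF.

Variables (H : groupType) (ev : UMagmaMorphism.type G H).
Hypothesis evR : forall r, r \in R -> ev r = 1.

Lemma ev_normal_closure y : normal_closure R y -> ev y = 1.
Proof.
elim=> [r /evR //||y1 y2 _ E1 _ E2|y1 _ E1|y1 y2 _ E1].
- exact: gmulf1.
- by rewrite gmulfM E1 E2 mulg1.
- by rewrite gmulfV E1 invg1.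
by rewrite gmulfJ E1 conj1g.
Qed.

Definition quotient_lift (u : quotient_group R) : H := ev (repr u).

Lemma quotient_lift_proj y : quotient_lift (quotient_proj R y) = ev y.
Proof.
apply/esym/divg1_eq; rewrite /quotient_lift.
have := ev_normal_closure (quotient_repr R y).
rewrite gmulfM gmulfV => /(congr1 (fun u => ev (repr (quotient_proj R y)) * u)).
by rewrite mulVKg mulg1 => ->; rewrite mulgV.
Qed.

Lemma quotient_liftM : {morph quotient_lift : u u' / u * u'}.
Proof.
move=> u u'; rewrite -[u]quotient_projK -[u']quotient_projK -gmulfM.
by rewrite !quotient_lift_proj gmulfM.
Qed.

Lemma quotient_lift1 : quotient_lift 1 = 1.
Proof. by rewrite -[1]/(quotient_proj R 1) quotient_lift_proj gmulf1. Qed.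

Definition quotient_lift_hom : UMagmaMorphism.type (quotient_group R) H :=
  HB.pack quotient_lift
    (isUMagmaMorphism.Build _ _ quotient_lift (quotient_lift1, quotient_liftM)).

End Quotient.

Section FreeWords.
Local Open Scope group_scope.
Variable X : choiceType.

Lemma free_words (y : free_group X) :
  words (fun z => exists c, z = free_gen c \/ z = (free_gen c)^-1) y.
Proof.
have -> : y = free_red y by apply: val_inj; rewrite /= reduce_id //; apply: valP.
elim: (word y) => [|[c e] u IH]; first exact: words1.
have -> : free_red ((c, e) :: u) = free_red [:: (c, e)] * free_red u.
  by apply: val_inj; rewrite -[RHS]/(reduce ([:: (c, e)] ++ reduce u)) reduce_catr.
apply: words_mul => //; apply: words_gen; exists c; case: e; last by left.
by right; apply: val_inj.
Qed.
End FreeWords.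

Section TauMorph.
Local Open Scope group_scope.
Variables (n : nat) (G H : groupType) (f : UMagmaMorphism.type G H) (a b : G).

Lemma tau_lower_morph d j : f (tau_lower a b d j) = tau_lower (f a) (f b) d j.
Proof.
have fb j' : f (a ^- j'.-1 * b * a ^+ j'.-1) = f a ^- j'.-1 * f b * f a ^+ j'.-1.
  by rewrite !gmulfM gmulfV !gmulfXn.
elim: d j => [|[|d] IH] j; [by rewrite /= gmulf1 | exact: fb | ].
by rewrite -[LHS]/(f [~ tau_lower a b d.+1 j.+1, a ^- j.-1 * b * a ^+ j.-1]) gmulfR IH fb.
Qed.

Lemma tau_morph i j : f (tau n a b i j) = tau n (f a) (f b) i j.
Proof.
have last_morph i' : f (tau_last n a b i') = tau_last n (f a) (f b) i'.
  have f1n : f (tau_1n n a b) = tau_1n n (f a) (f b).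
    by rewrite /tau_1n; case: (odd n); rewrite ?gmulfV !gmulfM gmulfV !gmulfXn.
  by rewrite /tau_last; case: eqP => // _; rewrite gmulfR tau_lower_morph f1n.
rewrite /tau; case: ifP => _; first exact: tau_lower_morph.
by case: ifP => _ //; rewrite gmulfR last_morph tau_lower_morph.
Qed.

Lemma weyl_morph i : f (weyl n a b i) = weyl n (f a) (f b) i.
Proof. by rewrite /weyl !gmulfM gmulfV !tau_morph. Qed.

End TauMorph.

(** * The index lists *)

Section Indices.
Variable n : nat.

Lemma index_pairsP (p : nat * nat) : reflect
  (exists i j : 'I_n, i != j /\ p = (i.+1, j.+1)) (p \in index_pairs n).
Proof.
apply: (iffP idP) => [|[i [j [ij ->]]]].
  case: p => i j; rewrite mem_filter /= => /andP[ij] /allpairsP[[i' j'] /= []].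
  rewrite !mem_iota !add1n !ltnS => /andP[i0 ilt] /andP[j0 jlt] [? ?]; subst i' j'.
  have lti : i.-1 < n by lia. have ltj : j.-1 < n by lia.
  exists (Ordinal lti), (Ordinal ltj); rewrite -(inj_eq val_inj) /= !prednK //.
  by split=> //; lia.
rewrite mem_filter /= eqSS (inj_eq val_inj) ij /=; apply/allpairsP.
by exists (i.+1, j.+1); rewrite !mem_iota /= !add1n !ltnS !ltn_ord.
Qed.

Lemma commuting_pairsP (pq : (nat * nat) * (nat * nat)) : reflect
  (exists i j k l : 'I_n, [/\ i != j, k != l, (i, j) != (k, l), i != l & j != k] /\
     pq = ((i.+1, j.+1), (k.+1, l.+1))) (pq \in commuting_pairs n).
Proof.
apply: (iffP idP) => [|[i [j [k [l [[ij kl ne il jk] ->]]]]]].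
  rewrite mem_filter => /andP[+ /allpairsP[[p q] /= [/index_pairsP[i [j [ij ->]]]
    /index_pairsP[k [l [kl ->]]] E]]]; rewrite E /= => /and3P[ne il jk].
  exists i, j, k, l; split; last by [].
  by split; rewrite // ?xpair_eqE -!(inj_eq val_inj) -?eqSS.
rewrite mem_filter /= !xpair_eqE !eqSS !(inj_eq val_inj) il jk -xpair_eqE ne /=.
by apply/allpairsP; exists ((i.+1, j.+1), (k.+1, l.+1)); split=> //; apply/index_pairsP;
  [exists i, j | exists k, l].
Qed.

Lemma index_triplesP (t : nat * nat * nat) : reflect
  (exists i j k : 'I_n, [/\ i != j, j != k & i != k] /\ t = (i.+1, j.+1, k.+1))
  (t \in index_triples n).
Proof.
apply: (iffP idP) => [|[i [j [k [[ij jk ik] ->]]]]].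
  rewrite mem_filter => /andP[+ /allpairsP[[p k] /= [/index_pairsP[i [j [ij ->]]]]]].
  rewrite mem_iota add1n ltnS => + + E; rewrite E /= => /andP[k0 kn] /andP[ik jk].
  have ltk : k.-1 < n by lia.
  exists i, j, (Ordinal ltk); rewrite -!(inj_eq val_inj) /= prednK //.
  by split=> //; split=> //; lia.
rewrite mem_filter /= !eqSS !(inj_eq val_inj) jk ik /=; apply/allpairsP.
exists ((i.+1, j.+1), k.+1); split=> //; first by apply/index_pairsP; exists i, j.
by rewrite mem_iota /= add1n ltnS ltn_ord.
Qed.

End Indices.

(** * The presentation *)

Section Presentation.
Local Open Scope group_scope.
Variables (n : nat) (hn : 2 < n).
Let n_gt1 : 1 < n := ltnW hn.
Let n_gt0 : 0 < n := ltnW n_gt1.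
Let first : 'I_n := Ordinal n_gt0.
Let second : 'I_n := Ordinal n_gt1.

Definition a_SL : SL n int := weyl_prod n_gt0 (@elem n) n.-1.
Definition b_SL : SL n int := elem second first.

Lemma SLval_a : SLval a_SL = mx_a n.
Proof. exact: weyl_prod_mx_a. Qed.

Lemma SLval_b : SLval b_SL = mx_b n.
Proof.
rewrite /b_SL elemE //; apply/matrixP => p q; rewrite !mxE /=.
by rewrite !eqSS -!(inj_eq val_inj).
Qed.

Lemma tau_SL (i j : 'I_n) : i != j -> tau n a_SL b_SL i.+1 j.+1 = elem i j.
Proof.
apply: (tauE (n_gt0 := n_gt0)).
- exact: elem_commg.
- by move=> i' i1; rewrite /b_SL; congr (elem _ _); apply: val_inj.
- exact: (elem_shift n_gt1 SLval_a).
exact: (elem_wrap n_gt1 SLval_a).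
Qed.

(* Keeping both orientations of the commutativity relations and keeping exactly
   one of them are treated together. *)
Variable o : rel (nat * nat).
Hypothesis o_total : forall p q, p != q -> o p q || o q p.
Let R := relators n gen_a gen_b o.

Let ev : UMagmaMorphism.type (free_group bool) (SL n int) :=
  free_eval (fun c : bool => if c then b_SL else a_SL).

Let ev_a : ev gen_a = a_SL. Proof. exact: free_eval_gen. Qed.
Let ev_b : ev gen_b = b_SL. Proof. exact: free_eval_gen. Qed.

Let ev_tau (i j : 'I_n) : i != j -> ev (tau n gen_a gen_b i.+1 j.+1) = elem i j.
Proof. by move=> ij; rewrite tau_morph ev_a ev_b tau_SL. Qed.

Lemma elem_w4 : wsgn (@elem n) first second false ^+ 4 = 1.
Proof.
set W := wsgn _ _ _ _; have -> : W ^+ 4 = W * (W * (W * (W * 1))) by rewrite mulg1.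
rewrite {}/W.
apply: val_inj; apply/matrixP => p q; rewrite -[LHS]/(SLval _ p q) -[RHS]/(SLval _ p q).
rewrite !w_elem_mul //; case: (eqVneq p first) => [->|p1]; first by rewrite !eqxx /= opprK.
by case: (eqVneq p second) => [->|p2]; rewrite ?eqxx ?opprK.
Qed.

Lemma ev_relators r : r \in R -> ev r = 1.
Proof.
case/mapP => [[u u'] + ->] /=; rewrite gmulfF => ru; suff -> : ev u = ev u' by rewrite mulgV.
move: ru; rewrite !mem_cat => /orP[/mapP[pq]|/orP[/mapP[t]|]].
- rewrite mem_filter => /andP[_ /commuting_pairsP[i [j [k [l [[ij kl ne il jk] ->]]]]]] [-> ->].
  rewrite gmulfR !ev_tau // gmulf1; apply/eqP/commgP.
  by apply: elem_comm; rewrite // eq_sym.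
- case/index_triplesP => i [j [k [[ij jk ik] ->]]] [-> ->] /=.
  by rewrite gmulfR !ev_tau // elem_commg.
rewrite !inE => /orP[/eqP[-> ->]|/eqP[-> ->]].
  rewrite gmulf1 gmulfXn !gmulfM gmulfV.
  by rewrite (@ev_tau first second) // (@ev_tau second first) // elem_w4.
rewrite gmulf_prod ev_a.
rewrite (eq_bigr (fun i => weyl n a_SL b_SL i)); last first.
  by move=> i _; rewrite weyl_morph ev_a ev_b.
by rewrite (weylE n_gt0 (x := @elem n)) //; apply: tau_SL.
Qed.

Let pr : UMagmaMorphism.type (free_group bool) (quotient_group R) := quotient_proj R.
Let a := pr gen_a.
Let b := pr gen_b.
Let x (i j : 'I_n) : quotient_group R := tau n a b i.+1 j.+1.

Let pr_tau i j : pr (tau n gen_a gen_b i j) = tau n a b i j.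
Proof. by rewrite tau_morph. Qed.

Let relationP u u' : (u, u') \in relations n gen_a gen_b o -> pr u = pr u'.
Proof.
move=> ru; apply: divg1_eq; rewrite -gmulfF -[1]/(pr 1); apply/esym/quotient_projP.
rewrite invg1 mul1g; apply: NormalClosure_gen.
by apply/mapP; exists (u, u').
Qed.

Lemma relators_comm i j k l : i != j -> k != l -> i != l -> j != k -> commute (x i j) (x k l).
Proof.
move=> ij kl il jk.
have [[-> ->]|ne] := eqVneq (i, j) (k, l); first exact: commute_refl.
have C (i' j' k' l' : 'I_n) :
    i' != j' -> k' != l' -> (i', j') != (k', l') -> i' != l' -> j' != k' ->
    o (i'.+1, j'.+1) (k'.+1, l'.+1) -> commute (x i' j') (x k' l').
  move=> ij' kl' ne' il' jk' oo; apply/commgP/eqP.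
  rewrite /x -!pr_tau -gmulfR.
  have := @relationP [~ tau n gen_a gen_b i'.+1 j'.+1, tau n gen_a gen_b k'.+1 l'.+1] 1.
  rewrite gmulf1; apply; rewrite mem_cat; apply/orP; left.
  apply/mapP; exists ((i'.+1, j'.+1), (k'.+1, l'.+1)) => //.
  rewrite mem_filter /= oo; apply/commuting_pairsP.
  by exists i', j', k', l'.
have ne1 : (i.+1, j.+1) != (k.+1, l.+1) by rewrite xpair_eqE !eqSS !(inj_eq val_inj) -xpair_eqE.
have /orP[oo|oo] := o_total ne1; first exact: C.
by apply/commute_sym/C; rewrite // eq_sym.
Qed.

Lemma relators_commg i j k : i != j -> j != k -> i != k -> [~ x i j, x j k] = x i k.
Proof.
move=> ij jk ik; rewrite /x -!pr_tau -gmulfR.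
apply: relationP; rewrite !mem_cat; apply/orP; right; apply/orP; left.
apply/mapP; exists (i.+1, j.+1, k.+1) => //; apply/index_triplesP.
by exists i, j, k.
Qed.

Lemma relators_w4 : wsgn x first second false ^+ 4 = 1.
Proof.
pose t (i j : nat) := tau n gen_a gen_b i j.
have := @relationP ((t 1%N 2%N * (t 2%N 1%N)^-1 * t 1%N 2%N) ^+ 4) 1.
rewrite gmulf1 gmulfXn !gmulfM gmulfV !pr_tau; apply.
by rewrite !mem_cat !inE eqxx /= !orbT.
Qed.

(** The last relation expresses a through the x_ij, and b is x_21 by the definition of
    the words tau. *)
Lemma relators_generate u : words (corner_gens x n) u.
Proof.
have Xw i j s : i != j -> words (corner_gens x n) (xsgn x i j s).
  by move=> ij; apply: words_gen; exists i, j, s; split.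
have wordsV y : words (corner_gens x n) y -> words (corner_gens x n) y^-1.
  by apply: words_inv => z [i [j [s [im jm ij ->]]]]; exists i, j, (~~ s); rewrite xsgnV.
have wa : words (corner_gens x n) a.
  have -> : a = weyl_prod n_gt0 x n.-1.
    have := @relationP gen_a (\big[*%g/1]_(i <- rev (iota 1 n.-1)) weyl n gen_a gen_b i).
    rewrite gmulf_prod (eq_bigr (fun i => weyl n a b i)) => [E|i _]; last exact: weyl_morph.
    by rewrite -(@weylE n n_gt0 _ x a b) //; apply: E; rewrite !mem_cat !inE eqxx !orbT.
  rewrite /weyl_prod big_seq; apply: big_ind; [exact: words1 | exact: words_mul |] => i.
  rewrite mem_rev mem_iota => /andP[i_gt0 lt_in].
  have ij : insubd first i.-1 != insubd first i.
    by rewrite -(inj_eq val_inj) !val_insubd !ifT; lia.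
  by apply: words_mul; [apply: words_mul|]; apply: Xw; rewrite // eq_sym.
have wb : words (corner_gens x n) b.
  have -> : b = xsgn x second first false; last exact: Xw.
  by rewrite /xsgn /x /tau /= invg1 mul1g mulg1.
rewrite -[u]quotient_projK; elim: (free_words (repr u)) => [|y z _ IH [c cz]].
  by rewrite gmulf1; apply: words1.
rewrite gmulfM; apply: words_mul => //.
by case: cz => ->; rewrite ?gmulfV; [|apply: wordsV]; case: c.
Qed.

Theorem presents_relators : presents_SLZ n R.
Proof.
pose f := quotient_lift_hom (H := SL n int) (ev := ev) ev_relators.
have f_pr y : f (pr y) = ev y by exact: (quotient_lift_proj ev_relators).
have f_x i j : i != j -> SLval (f (x i j)) = (1%:M + delta_mx i j)%R.
  by move=> ij; rewrite /x -pr_tau f_pr ev_tau // elemE.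
have f_inj : injective f.
  apply: gmulf_inj => u.
  apply: (faithful hn relators_comm relators_commg _ relators_w4 f_x (leqnn n)) => //.
  exact: relators_generate.
have f_surj A : exists u, f u == A.
  elim: (elem_generate A) => [|g y _ [u /eqP <-] [i [j [s [_ _ ij ->]]]]].
    by exists 1; rewrite gmulf1.
  exists (u * xsgn x i j s); rewrite gmulfM; apply/eqP; congr (_ * _).
  apply: val_inj; apply: etrans (SLval_xsgn f_x s ij) _.
  exact/esym/(SLval_xsgn (f := idfun) (@elemE n) s ij).
exists f; split.
- exists (fun A => xchoose (f_surj A)) => [u|A]; last exact/eqP/(xchooseP (f_surj A)).
  by apply: f_inj; apply/eqP/(xchooseP (f_surj _)).
- by rewrite f_pr ev_a SLval_a.
by rewrite f_pr ev_b SLval_b.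
Qed.

End Presentation.

(** * Counting the relators *)

Section Counting.
Variables (n : nat) (n_ge2 : 1 < n).
Let I := iota 1 n.

Lemma count_pairs (S T : Type) (P : pred (S * T)) (s : seq S) (t : seq T) :
  count P [seq (p, q) | p <- s, q <- t] = \sum_(p <- s) count (fun q => P (p, q)) t.
Proof.
elim: s => [|p s IH]; first by rewrite big_nil.
by rewrite allpairs_cons count_cat count_map IH big_cons.
Qed.

Lemma count_ne1 i : i \in I -> count (fun j => j != i) I = n.-1.
Proof.
move=> iI; have := count_predC (pred1 i) I.
rewrite (count_uniq_mem _ (iota_uniq 1 n)) iI size_iota add1n => <-.
exact: eq_count.
Qed.

Lemma count_ne2 i j : i \in I -> j \in I -> i != j ->
  count (fun k => (k != i) && (k != j)) I = n.-2.
Proof.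
move=> iI jI ij; have := count_predC (predU (pred1 i) (pred1 j)) I.
have := count_predUI (pred1 i) (pred1 j) I.
rewrite !(count_uniq_mem _ (iota_uniq 1 n)) iI jI size_iota.
rewrite (@eq_count _ (predI _ _) pred0) ?count_pred0; last first.
  by move=> k /=; case: eqP => // ->; rewrite (negPf ij).
rewrite (@eq_count _ (predC _) (fun k => (k != i) && (k != j))); last first.
  by move=> k /=; rewrite negb_or.
lia.
Qed.

Lemma size_index_pairs : size (index_pairs n) = n * n.-1.
Proof.
rewrite size_filter count_pairs -/I big_seq (eq_bigr (fun=> n.-1)).
  by rewrite -big_seq big_const_seq count_predT size_iota iter_addn_0 mulnC.
by move=> i iI; rewrite -(count_ne1 iI); apply: eq_count => j /=; rewrite eq_sym.
Qed.

Lemma mem_index_pairs p : p \in index_pairs n -> [/\ p.1 \in I, p.2 \in I & p.1 != p.2].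
Proof.
by rewrite mem_filter => /andP[+ /allpairsP[[i j] [iI jI E]]]; rewrite E.
Qed.

Definition commuting_indices (p q : nat * nat) : bool :=
  [&& p != q, p.1 != q.2 & p.2 != q.1].

(** Let p = (i, j).  For each first index k <> j there are n - 2 second indices l: one
    excludes k and i if k <> i, and i and j if k = i. *)
Lemma count_commuting p : p \in index_pairs n ->
  count (commuting_indices p) (index_pairs n) = n.-1 * n.-2.
Proof.
case: p => i j /mem_index_pairs[/= iI jI ij].
rewrite count_filter count_pairs -/I.
rewrite (eq_big_seq (fun k => if k != j then n.-2 else 0)); last first.
  move=> k kI; case: (eqVneq k j) => [->|kj].
    rewrite (@eq_count _ _ pred0) ?count_pred0 // => l.
    by rewrite /= /commuting_indices /= eqxx !andbF.
  case: (eqVneq k i) => [ki|ki].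
    subst k; rewrite -(count_ne2 iI jI ij); apply: eq_count => l /=.
    rewrite /commuting_indices /= xpair_eqE eqxx /= [j == i]eq_sym ij.
    by rewrite [i == l]eq_sym [j == l]eq_sym; case: (l == i); case: (l == j).
  rewrite -(count_ne2 iI kI) 1?eq_sym //; apply: eq_count => l /=.
  rewrite /commuting_indices /= xpair_eqE [i == k]eq_sym (negPf ki) /= [j == k]eq_sym kj andbT.
  by rewrite [i == l]eq_sym [k == l]eq_sym; case: (l == i); case: (l == k).
rewrite -big_mkcond /= big_const_seq iter_addn_0 (eq_count (a2 := fun k => k != j)) //.
by rewrite count_ne1 // mulnC.
Qed.

Lemma size_triples : size (index_triples n) = n * n.-1 * n.-2.
Proof.
rewrite size_filter count_pairs -/I (eq_big_seq (fun=> n.-2)).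
  by rewrite big_const_seq count_predT size_index_pairs iter_addn_0 mulnC.
case=> i j /mem_index_pairs[/= iI jI ij]; rewrite -(count_ne2 iI jI ij).
by apply: eq_count => k /=; rewrite ![_ == k]eq_sym.
Qed.

(** Summing over all ordered pairs (p, q) and exchanging p and q counts each pair of
    commuting indices once in the orientation o and once in the opposite one. *)
Lemma size_commuting (o : rel (nat * nat)) : orientation o ->
  (size [seq pq <- commuting_pairs n | o pq.1 pq.2]).*2 = n * n.-1 * (n.-1 * n.-2).
Proof.
move=> oo; set J := index_pairs n.
have E : size [seq pq <- commuting_pairs n | o pq.1 pq.2]
    = \sum_(p <- J) \sum_(q <- J) (commuting_indices p q && o p q).
  rewrite /commuting_pairs -filter_predI size_filter count_pairs; apply: eq_bigr => p _.
  rewrite -sum1_count big_mkcond; apply: eq_bigr => q _ /=.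
  by rewrite andbC /commuting_indices; case: (_ && _).
have sym p q : commuting_indices p q = commuting_indices q p.
  by rewrite /commuting_indices eq_sym [p.1 == _]eq_sym [p.2 == _]eq_sym [_ && (q.2 != _)]andbC.
rewrite -addnn {1}E E [X in _ + X]exchange_big -big_split /=.
rewrite (eq_big_seq (fun=> n.-1 * n.-2)) => [|p pJ].
  by rewrite big_const_seq count_predT size_index_pairs iter_addn_0 mulnC.
rewrite -(count_commuting pJ) -sum1_count [RHS]big_mkcond -big_split; apply: eq_bigr => q _ /=.
rewrite (sym q p); case dpq : (commuting_indices p q) => //=.
by case/and3P: dpq => /oo; case: (o p q); case: (o q p).
Qed.

End Counting.

Lemma size_relators n (G : groupType) (a b : G) o : 1 < n -> orientation o ->
  size (relators n a b o) = (n * (n + 1) * (n - 1) * (n - 2)) %/ 2 + 2.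
Proof.
move=> n_gt1 oo; rewrite /relators size_map !size_cat !size_map size_triples //= addnA.
congr (_ + _).
have C := size_commuting n_gt1 oo.
rewrite -[LHS](@mulnK _ 2) //; congr (_ %/ 2).
rewrite mulnDl muln2 C.
case: n n_gt1 {oo C} => [|[|m]] // _; rewrite /= addn1 subn1 subn2 /=.
nia.
Qed.

(* The first conjunct is about the full list of relations, in which every
   commutativity relation occurs in both orientations; the second one is about
   the lists in which a single orientation of each of them is kept. *)
Theorem proposition5p5 (n : nat) (hn : (3 <= n)%N) :
  presents_SLZ n (relators n gen_a gen_b (fun _ _ => true)) /\
  forall o : rel (nat * nat), orientation o ->
    presents_SLZ n (relators n gen_a gen_b o) /\
    size (relators n gen_a gen_b o)
      = ((n * (n + 1) * (n - 1) * (n - 2)) %/ 2 + 2)%N.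
Proof.
split; first exact: presents_relators.
move=> o o_orient; split; last by apply: size_relators; rewrite // ltnW.
by apply: presents_relators => // p q /o_orient; case: (o p q); case: (o q p).
Qed.
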